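(* Let $(a,b,c)\in\mathbb{R}^3$ be such that $b\neq(2-a)c$. Let $(\Sigma,ds^2)$ be a generalized Ricci surface of type $(a,b,c)$ whose curvature $K$ is not identically $c$. Let $\Sigma_*=\{x\in\Sigma\mid K(x)\neq c\}$. Let $\varepsilon=\operatorname{sign}(K-c)$. Then $(\Sigma_*,|K-c|ds^2)$ is a generalized Ricci surface of type $$\left(\frac{2(ac+b)}{b+(a-2)c},\,-\frac{2\varepsilon b}{b+(a-2)c},\,\varepsilon\left(1-\frac a2\right)\right),$$ and its curvature $\tilde K$ satisfies $$\tilde K-\varepsilon\left(1-\frac a2\right)=-\frac{b+(a-2)c}2\,\varepsilon\,(K-c)^{-1}.$$
   Context: Smooth means of class $C^\infty$; surfaces are connected and without boundary. For $(a,b,c)\in\mathbb{R}^3$, a smooth Riemannian surface $(\Sigma,ds^2)$ with Gaussian curvature $K$ is a generalized Ricci surface of type $(a,b,c)$ if $(c-K)\Delta K+\|\nabla K\|^2+(aK+b)(K-c)^2=0$ on $\Sigma$, where $\Delta=\operatorname{div}\nabla$. For a real-valued function $F$, $\operatorname{sign}F=1$ (resp. $\operatorname{sign}F=-1$) means $F\geqslant0$ and $F\not\equiv0$ (resp. $F\leqslant0$ and $F\not\equiv0$). For a generalized Ricci surface of type $(a,b,c)$ with $K\not\equiv c$, the zeroes of $K-c$ are isolated and $K-c$ does not change sign, so $\varepsilon\in\{-1,1\}$ is well defined. *)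

(* Defs.v *)
From HB Require Import structures.
From mathcomp Require Import all_boot all_order all_algebra.
From mathcomp Require Import all_classical all_reals all_analysis.

Set Implicit Arguments.
Unset Strict Implicit.
Unset Printing Implicit Defensive.

Import Order.TTheory GRing.Theory Num.Theory.
Import numFieldNormedType.Exports.

Local Open Scope classical_set_scope.
Local Open Scope ring_scope.

(* Raw data of a smooth surface with a metric: a space, a family of charts
   [coord i : dom i -> R^2], and for each chart the matrix-valued function
   [metric i] of the components of ds^2 at points of [dom i].  Values outside
   [dom i] are junk.  The axioms are in [riemannian_surface]. *)
Record surface (R : realType) : Type := Surface {
  carrier :> topologicalType;
  chart : Type;
  dom : chart -> set carrier;
  coord : chart -> carrier -> 'rV[R]_2;
  metric : chart -> carrier -> 'M[R]_2
}.
Arguments dom {R s}.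
Arguments coord {R s}.
Arguments metric {R s}.

Section LocalCalculus.
Variables (R : realType) (S : surface R) (i : chart S).
Implicit Types (f : S -> R) (x : S) (k l m p : 'I_2).

(* f o (coord i)^-1 on the image of [dom i], and 0 elsewhere: the set below is
   a singleton or empty because [coord i] is injective on [dom i]. *)
Definition in_chart f (v : 'rV[R]_2) : R :=
  xget 0 (f @` (dom i `&` coord i @^-1` [set v])).

(* The partial derivative of f along the k-th coordinate of the chart i, again
   as a function on the surface (meaningful on [dom i]). *)
Definition pderiv k f x : R :=
  'D_(delta_mx 0 k) (in_chart f) (coord i x).

(* C^oo regularity on an open subset W of [dom i]: all iterated partial
   derivatives, of every order, exist and are continuous. *)
Definition smooth_in (W : set S) f : Prop :=
  forall (s : seq 'I_2) x, W x ->
    {for x, continuous (foldr pderiv f s)} /\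
    forall k, derivable (in_chart (foldr pderiv f s)) (coord i x)
                (delta_mx 0 k).

Definition inv_metric x : 'M[R]_2 := invmx (metric i x).

(* Christoffel symbol Gamma^k_{l m} of the Levi-Civita connection. *)
Definition christoffel k l m x : R :=
  2^-1 * \sum_p inv_metric x k p *
    (pderiv l (fun y => metric i y m p) x +
     pderiv m (fun y => metric i y l p) x -
     pderiv p (fun y => metric i y l m) x).

(* The p-th component of R(d_k, d_l) d_m, where
   R(X, Y) = [nabla_X, nabla_Y] - nabla_[X, Y]. *)
Definition riemann p k l m x : R :=
  pderiv k (christoffel p l m) x - pderiv l (christoffel p k m) x +
  \sum_(q < 2) (christoffel q l m x * christoffel p k q x -
                christoffel q k m x * christoffel p l q x).

(* ds^2(R(d_0, d_1) d_1, d_0) / det ds^2: the sectional curvature of the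
   tangent plane. *)
Definition chart_curvature x : R :=
  (\sum_p riemann p 0 1 1 x * metric i x p 0) / \det (metric i x).

(* Vector fields are given by their components in the coordinate frame. *)
Definition grad f x (k : 'I_2) : R :=
  \sum_l inv_metric x k l * pderiv l f x.

Definition sq_norm (X : 'I_2 -> R) x : R :=
  \sum_k \sum_l metric i x k l * X k * X l.

Definition vol x : R := Num.sqrt (\det (metric i x)).

Definition divergence (X : S -> 'I_2 -> R) x : R :=
  (vol x)^-1 * \sum_k pderiv k (fun y => vol y * X y k) x.

Definition laplacian f x : R := divergence (grad f) x.

End LocalCalculus.

Section Surfaces.
Variable R : realType.
Implicit Type S : surface R.

(* A connected, Hausdorff, second countable smooth 2-manifold without boundary
   with a smooth Riemannian metric. *)
Record riemannian_surface S : Prop := RiemannianSurface {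
  surface_connected : connected [set: S];
  surface_hausdorff : hausdorff_space S;
  surface_second_countable : @second_countable S;
  (* each coord i is a homeomorphism of the open set dom i onto an open set *)
  dom_open : forall i : chart S, open (dom i);
  dom_cover : forall x : S, exists i : chart S, dom i x;
  coord_inj : forall (i : chart S) (x y : S),
    dom i x -> dom i y -> coord i x = coord i y -> x = y;
  coord_continuous : forall (i : chart S) (x : S),
    dom i x -> {for x, continuous (coord i)};
  coord_open : forall (i : chart S) (V : set S),
    V `<=` dom i -> open V -> open (coord i @` V);
  transition_smooth : forall (i j : chart S) (k : 'I_2),
    smooth_in i (dom i `&` dom j) (fun x => coord j x 0 k);
  metric_smooth : forall (i : chart S) (k l : 'I_2),
    smooth_in i (dom i) (fun x => metric i x k l);
  metric_sym : forall (i : chart S) (x : S),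
    dom i x -> (metric i x)^T = metric i x;
  metric_posdef : forall (i : chart S) (x : S) (v : 'rV[R]_2),
    dom i x -> v != 0 -> 0 < (v *m metric i x *m v^T) 0 0;
  metric_transition : forall (i j : chart S) (x : S), dom i x -> dom j x ->
    let J := \matrix_(k < 2, l < 2) pderiv i k (fun y => coord j y 0 l) x in
    metric i x = J *m metric j x *m J^T
}.

(* K is the Gaussian curvature of S; it determines K, as the charts cover. *)
Definition gaussian_curvature S (K : S -> R) : Prop :=
  forall (i : chart S) (x : S), dom i x -> K x = chart_curvature i x.

Definition generalized_ricci_surface S (a b c : R) : Prop :=
  riemannian_surface S /\
  exists2 K : S -> R, gaussian_curvature K &
    forall (i : chart S) (x : S), dom i x ->
      (c - K x) * laplacian i K x + sq_norm i (grad i K x) x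
        + (a * K x + b) * (K x - c) ^+ 2 = 0.

(* The subset A of S with the subspace topology, the restricted charts, and the
   metric u ds^2. *)
Definition conformal_restriction S (A : set S) (u : S -> R) : surface R :=
  @Surface R A (chart S)
    (fun i (x : A) => dom i (set_val x))
    (fun i (x : A) => coord i (set_val x))
    (fun i (x : A) => u (set_val x) *: metric i (set_val x)).

(* The value 0 is junk: F is identically zero or changes sign. *)
Definition fsign (T : Type) (F : T -> R) : R :=
  if `[< (forall x, 0 <= F x) /\ exists x, F x != 0 >] then 1
  else if `[< (forall x, F x <= 0) /\ exists x, F x != 0 >] then -1
  else 0.

End Surfaces.

(* Main.v *)
Require Import Defs.
From HB Require Import structures.
From mathcomp Require Import all_boot all_order all_algebra.
From mathcomp Require Import all_classical all_reals all_analysis.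
From mathcomp Require Import ring lra.
Set Implicit Arguments.
Unset Strict Implicit.
Unset Printing Implicit Defensive.
Import Order.TTheory GRing.Theory Num.Theory.
Import numFieldNormedType.Exports.
Local Open Scope classical_set_scope.
Local Open Scope ring_scope.

(** Write u = K - c.  Where u does not vanish, the Ricci equation of type
    (a, b, c) says that the Laplacian of ln |u| is a K + b.  The theorem rests
    on two facts about this reformulation.

    Conformal change.  For w > 0 the metric w ds^2 has curvature
    w^-1 (K - 1/2 Laplacian (ln w)), and on a surface its Laplacian and its
    squared gradients are those of ds^2 divided by w ([chart_curvature_conf],
    [laplacian_conf], [sqgrad_conf]).  For w = |u| = s u, where s = 1 or -1 is
    the sign of u, this curvature is w^-1 (K - (a K + b) / 2), that is
    s (1 - a / 2) + kap / w with kap = - (b + (a - 2) c) / 2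
    ([dual_curvature]).  Minus s (1 - a / 2) it is a multiple of 1 / w, nonzero
    as b <> (2 - a) c, so up to a constant the logarithm of its absolute value
    is - ln w, and the equation for ln w turns into the Ricci equation of the
    new type ([dual_ricci]).

    Unique continuation.  The conformal metric lives on a connected surface,
    and u has a sign, because of the following.  Let the set where u <> 0 be
    the union of two disjoint open sets P and Q, with s u > 0 on P.  Let f be
    |u| on P and 0 elsewhere.  Then f is continuous and nonnegative, and the
    Laplacian of ln f is bounded below where f > 0.  If such a function
    vanishes on a small coordinate disc about q, let rho be the squared
    coordinate distance to q.  For al large, h = exp (- al rho) has a
    Laplacian bounded below by a positive constant on an annulus about q, so
    that ln f + N h has no interior maximum for N large.  As f vanishes on the
    inner circle, the maximum is attained on the outer one, and letting N grow
    yields f = 0 in the whole disc ([zero_propagation]).  The interior of the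
    zero set of f is therefore closed, so that f vanishes everywhere as soon
    as Q is nonempty ([vanishing_everywhere], [regular_part_connected]).
    Applied to the sets where u > 0 and u < 0 this gives the sign of u
    ([constant_sign]); applied to a separation of the set where u <> 0, it
    gives connectedness ([restriction_connected]).

    Everything is computed in a chart, in which the Laplacian is the trace of
    the covariant Hessian ([laplacianE]) and the first derivatives of the
    metric are expressed through the Christoffel symbols ([dmetricE]). *)

(** * Two-variable calculus *)

Local Notation axis := (delta_mx 0).

Section Lines.
Variables (R : realType).
Implicit Types (F : 'rV[R]_2 -> R) (v d : 'rV[R]_2).

Lemma line_quotientE F v d (t : R) :
  (fun h : R => h^-1 *: (((fun s : R => F (v + s *: d)) \o shift t) (h *: 1) -
     F (v + t *: d))) =
  (fun h : R => h^-1 *: ((F \o shift (v + t *: d)) (h *: d) - F (v + t *: d))).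
Proof.
by apply/funext => h /=; rewrite [h *: 1]mulr1 scalerDl addrCA.
Qed.

Lemma is_derive_lineE F v d (t : R) l :
  is_derive t (1:R) (fun s : R => F (v + s *: d)) l <->
  is_derive (v + t *: d) d F l.
Proof.
have E := line_quotientE F v d t.
split=> -[H D]; constructor.
- by move: H; rewrite /derivable E.
- by move: D; rewrite /derive E.
- by move: H; rewrite /derivable E.
- by move: D; rewrite /derive E.
Qed.

Lemma mvt_line F (F' : 'rV[R]_2 -> R) v d (s : R) :
  (forall t : R, 0 <= t <= 1 ->
     is_derive (v + (t * s) *: d) d F (F' (v + (t * s) *: d))) ->
  exists2 t : R, 0 <= t <= 1 &
    F (v + s *: d) - F v = s * F' (v + (t * s) *: d).
Proof.
move=> H.
have dg : forall t : R, 0 <= t <= 1 -> is_derive t (1:R)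
   (fun t : R => F (v + (t * s) *: d)) (F' (v + (t * s) *: d) * s).
  move=> t /H /is_derive_lineE h1.
  have h2 : is_derive t (1:R) (fun t : R => t * s) s.
    have := @is_deriveZ R R R id s t 1 1 (is_derive_id _ _).
    rewrite [s *: 1]mulr1; congr is_derive.
    by apply/funext => z; rewrite /= mulrC.
  exact: (@is_derive1_comp _ (fun s : R => F (v + s *: d)) _ t _ _ h1 h2).
have [] := @MVT_segment R (fun t : R => F (v + (t * s) *: d))
   (fun t => F' (v + (t * s) *: d) * s) 0 1 ler01.
- by move=> x hx; apply: dg; move: hx; rewrite in_itv /=; lra.
- apply: derivable_within_continuous => x; rewrite in_itv /= => hx.
  by have [] := dg _ hx.
- move=> t; rewrite in_itv /= => ht E; exists t => //.
  by move: E; rewrite mul1r mul0r scale0r addr0 subr0 mulr1 mulrC.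
Qed.

Lemma norm_axis_le (k : 'I_2) (s : R) : `|s *: axis k : 'rV[R]_2| <= `|s|.
Proof.
rewrite normrZ ler_piMr //.
rewrite [leLHS]/Num.norm /= mx_normrE; apply/bigmax_leP; split=> //= -[i j] _.
by rewrite mxE /=; case: (_ && _); rewrite ?normr1 ?normr0.
Qed.

Lemma rV2E (d : 'rV[R]_2) : d = d 0 0 *: axis 0 + d 0 1 *: axis 1.
Proof.
apply/rowP => j; rewrite !mxE /=.
have [->|->] : j = 0 \/ j = 1.
  by case: j => -[|[|//]] p; [left|right]; apply/val_inj.
all: by rewrite /= ?mulr1 ?mulr0 ?addr0 ?add0r.
Qed.

Lemma I2P (k : 'I_2) : k = 0 \/ k = 1.
Proof. by case: k => -[|[|//]] p; [left|right]; apply/val_inj. Qed.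

Lemma near_ball (P : 'rV[R]_2 -> Prop) v :
  (\forall w \near v, P w) ->
  exists2 del : R, 0 < del & forall s, `|s| < del -> P (v + s).
Proof.
move=> /nbhs_ballP [del /= del0 Hdel]; exists del => // s hs.
apply: Hdel; rewrite -ball_normE /ball_ /=.
by rewrite opprD addrA subrr add0r normrN.
Qed.

(** The derivative along an arbitrary direction exists as soon as the partial
    derivatives are continuous: going from v to v + h d along the two axes, the
    mean value theorem on each leg produces a partial derivative at a point
    close to v. *)
Lemma is_derive_partial F (F0 F1 : 'rV[R]_2 -> R) v d :
  (\forall w \near v, is_derive w (axis 0) F (F0 w)) ->
  (\forall w \near v, is_derive w (axis 1) F (F1 w)) ->
  {for v, continuous F0} -> {for v, continuous F1} ->
  is_derive v d F (d 0 0 * F0 v + d 0 1 * F1 v).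
Proof.
move=> hd0 hd1 hc0 hc1.
suff L : (fun h : R => h^-1 *: ((F \o shift v) (h *: d) - F v)) @ 0^' -->
   d 0 0 * F0 v + d 0 1 * F1 v.
  by constructor; [apply/cvg_ex; eexists; exact: L | apply: cvg_lim].
apply/cvgrPdist_le => /= eps eps0.
set M := `|d 0 0| + `|d 0 1| + 1.
have d0 := normr_ge0 (d 0 0); have d1 := normr_ge0 (d 0 1).
have M0 : 0 < M by rewrite /M; lra.
have e0 : 0 < eps / M by rewrite divr_gt0.
have n0 : \forall w \near v, `|F0 v - F0 w| <= eps / M.
  by have /cvgrPdist_le := hc0; apply.
have n1 : \forall w \near v, `|F1 v - F1 w| <= eps / M.
  by have /cvgrPdist_le := hc1; apply.
have [del del0 key] := near_ball (filterI (filterI hd0 n0) (filterI hd1 n1)).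
have : \forall h \near 0^', h != 0 :> R by exact: nbhs_dnbhs_neq.
apply: filter_app; apply: cvg_within; apply/nbhs_ballP.
exists (del / M); first by rewrite /= divr_gt0.
move=> h /=; rewrite -ball_normE /ball_ /= sub0r normrN => hh h0.
have small (t : R) (k : 'I_2) : 0 <= t <= 1 ->
    `|(t * (h * d 0 k)) *: axis k : 'rV[R]_2| <= `|h| * `|d 0 k|.
  move=> ht; apply: le_trans (norm_axis_le _ _) _.
  by rewrite !normrM ler_piMl // ger0_norm; lra.
have hM : `|h| * M < del by rewrite -ltr_pdivlMr.
have hn := normr_ge0 h.
have sm0 t : 0 <= t <= 1 -> `|(t * (h * d 0 0)) *: axis 0 : 'rV[R]_2| < del.
  move=> ht; apply: le_lt_trans (small t 0 ht) _.
  by apply: le_lt_trans hM; rewrite ler_wpM2l // /M; lra.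
have sm1 t : 0 <= t <= 1 ->
   `|(h * d 0 0) *: axis 0 + (t * (h * d 0 1)) *: axis 1 : 'rV[R]_2| < del.
  move=> ht; apply: le_lt_trans (ler_normD _ _) _.
  have := small 1 0; rewrite mul1r => /(_ _); have := small t 1 ht.
  move=> A /(_ ltac:(lra)) B; apply: le_lt_trans (lerD B A) _.
  by apply: le_lt_trans hM; rewrite -mulrDr ler_wpM2l // /M; lra.
have [|t0 ht0 E0] := @mvt_line F F0 v (axis 0) (h * d 0 0).
  by move=> t /sm0 /key [[]].
have [|t1 ht1 E1] := @mvt_line F F1 (v + (h * d 0 0) *: axis 0) (axis 1) (h * d 0 1).
  by move=> t ht; rewrite -addrA; have [_ []] := key _ (sm1 t ht).
have [[_ B0] _] := key _ (sm0 t0 ht0).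
have [_ [_ B1]] := key _ (sm1 t1 ht1).
have Ed : h *: d + v = v + (h * d 0 0) *: axis 0 + (h * d 0 1) *: axis 1.
  by rewrite [in LHS](rV2E d) scalerDr !scalerA addrC addrA.
rewrite /= Ed {Ed}.
set C0 := F0 (v + _) in E0 B0; set C1 := F1 (v + _) in B1.
move: E1; rewrite -[v + _ + (t1 * _) *: _]addrA -/C1 => E1.
have -> : F (v + (h * d 0 0) *: axis 0 + (h * d 0 1) *: axis 1) - F v =
   h * (d 0 0 * C0 + d 0 1 * C1).
  move: E0 E1; set x := F _; set y := F _; set z := F _ => E0 E1.
  have -> : z - y = (z - x) + (x - y) by ring.
  by rewrite E0 E1; ring.
rewrite [_ *: _]mulrA mulVf // mul1r.
have -> : d 0 0 * F0 v + d 0 1 * F1 v - (d 0 0 * C0 + d 0 1 * C1) =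
  d 0 0 * (F0 v - C0) + d 0 1 * (F1 v - C1) by ring.
apply: le_trans (ler_normD _ _) _; rewrite !normrM.
apply: (@le_trans _ _ (`|d 0 0| * (eps / M) + `|d 0 1| * (eps / M))).
  by rewrite lerD // ler_wpM2l.
by rewrite -mulrDl mulrCA ger_pMr // ler_pdivrMr // mul1r /M lerDl.
Qed.

(** The second difference of F over a square of side h is a mixed derivative at
    some point close to v: apply the mean value theorem along one axis to the
    first difference along the other one. *)
Lemma near_mixed_eq F (Fk Fkl : 'rV[R]_2 -> R) v (k l : 'I_2) (del : R) :
  0 < del ->
  (forall s, `|s| < del -> is_derive (v + s) (axis k) F (Fk (v + s)) /\
    is_derive (v + s) (axis l) Fk (Fkl (v + s))) ->
  let h := del / 3 in
  exists2 s, `|s| < del &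
  F (v + h *: axis k + h *: axis l) - F (v + h *: axis k) - (F (v + h *: axis l) - F v)
   = h * h * Fkl (v + s).
Proof.
move=> del0 H h.
have h0 : 0 < h by rewrite /h; lra.
have small (t t' : R) : 0 <= t <= 1 -> 0 <= t' <= 1 ->
  `|(t * h) *: axis k + (t' * h) *: axis l : 'rV[R]_2| < del.
  move=> ht ht'; apply: le_lt_trans (ler_normD _ _) _.
  have A1 := norm_axis_le k (t * h); have A2 := norm_axis_le l (t' * h).
  have nh (r : R) : 0 <= r <= 1 -> `|r * h| <= h.
    by move=> hr; rewrite ger0_norm ?mulr_ge0 ?ler_piMl //; lra.
  apply: le_lt_trans (lerD A1 A2) _.
  by have := nh _ ht; have := nh _ ht'; rewrite /h; lra.
set G := fun w => F (w + h *: axis l) - F w.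
have dsh w (c : 'rV[R]_2) (r : R) : is_derive (w + c) (axis k) F r ->
    is_derive w (axis k) (fun w => F (w + c)) r.
  have E : (fun h : R => h^-1 *: (((fun w => F (w + c)) \o shift w) (h *: axis k) - F (w + c)))
     = (fun h : R => h^-1 *: ((F \o shift (w + c)) (h *: axis k) - F (w + c))).
    by apply/funext => z /=; rewrite addrA.
  by move=> [D1 D2]; constructor; rewrite ?/derivable ?/derive E.
have sm0 (t : R) : 0 <= t <= 1 -> `|(t * h) *: axis k : 'rV[R]_2| < del.
  by move=> ht; have := small t 0 ht; rewrite mul0r scale0r addr0; apply; lra.
have sm1 (t : R) : 0 <= t <= 1 -> `|(t * h) *: axis k + h *: axis l : 'rV[R]_2| < del.
  by move=> ht; have := small t 1 ht; rewrite mul1r; apply; lra.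
have dG' t : 0 <= t <= 1 -> is_derive (v + (t * h) *: axis k) (axis k) G
   (Fk (v + (t * h) *: axis k + h *: axis l) - Fk (v + (t * h) *: axis k)).
  move=> ht; apply: is_deriveB; last exact: (H _ (sm0 _ ht)).1.
  by apply: dsh; rewrite -addrA; exact: (H _ (sm1 _ ht)).1.
have [t ht E] := @mvt_line G (fun w => Fk (w + h *: axis l) - Fk w) v (axis k) h dG'.
have [|t' ht' E'] := @mvt_line Fk Fkl (v + (t * h) *: axis k) (axis l) h.
  by move=> t' ht'; rewrite -addrA; exact: (H _ (small _ _ ht ht')).2.
exists ((t * h) *: axis k + (t' * h) *: axis l); first exact: small.
by move: E; rewrite /G E' => ->; rewrite addrA mulrA.
Qed.

(** The second difference of F over a square is symmetric in the two axes, so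
    both mixed derivatives take a common value at points arbitrarily close to
    v. *)
Lemma schwarz F (Fk Fl Fkl Flk : 'rV[R]_2 -> R) v (k l : 'I_2) :
  (\forall w \near v, is_derive w (axis k) F (Fk w)) ->
  (\forall w \near v, is_derive w (axis l) F (Fl w)) ->
  (\forall w \near v, is_derive w (axis l) Fk (Fkl w)) ->
  (\forall w \near v, is_derive w (axis k) Fl (Flk w)) ->
  {for v, continuous Fkl} -> {for v, continuous Flk} ->
  Fkl v = Flk v.
Proof.
move=> dk dl dkl dlk ckl clk.
apply/eqP; rewrite -subr_eq0 -normr_le0; apply/ler_addgt0Pl => eps eps0.
rewrite addr0.
have e2 : 0 < eps / 2 by rewrite divr_gt0.
have c1 : \forall w \near v, `|Fkl v - Fkl w| <= eps / 2.
  by have /cvgrPdist_le := ckl; apply.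
have c2 : \forall w \near v, `|Flk v - Flk w| <= eps / 2.
  by have /cvgrPdist_le := clk; apply.
have [del del0 key] := near_ball (filterI (filterI dk dkl)
  (filterI (filterI dl dlk) (filterI c1 c2))).
have [s hs|s hs Es] := @near_mixed_eq F Fk Fkl v k l del del0.
  by have [[]] := key s hs.
have [s' hs'|s' hs' Es'] := @near_mixed_eq F Fl Flk v l k del del0.
  by have [_ [[]]] := key s' hs'.
have [_ [_ [A _]]] := key _ hs; have [_ [_ [_ B]]] := key _ hs'.
have h0 : del / 3 != 0 by rewrite mulf_neq0 // ?gt_eqF // invr_gt0.
have EE : Fkl (v + s) = Flk (v + s').
  apply: (@mulfI _ (del / 3 * (del / 3))); first by rewrite mulf_neq0.
  by rewrite -Es -Es' [v + _ *: axis l + _]addrAC; ring.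
rewrite (splitr eps); move: B; rewrite distrC -EE => B.
exact: le_trans (ler_distD _ _ _) (lerD A B).
Qed.

(** If g2 were positive, g' would be positive on the right of its zero 0, and
    the mean value theorem would contradict maximality. *)
Lemma local_max_deriv2 (g g' : R -> R) (g2 : R) :
  (\forall t \near (0:R), is_derive t (1:R) g (g' t)) ->
  is_derive (0:R) (1:R) g' g2 ->
  (\forall t \near (0:R), g t <= g 0) ->
  g' 0 = 0 /\ g2 <= 0.
Proof.
move=> d1 d2 mx.
have : \forall t \near (0:R), is_derive t (1:R) g (g' t) /\ g t <= g 0.
  exact: filterI.
move=> /nbhs_ballP [del /= del0 key].
have key' t : `|t| < del -> is_derive t (1:R) g (g' t) /\ g t <= g 0.
  by move=> ht; apply: key; rewrite -ball_normE /ball_ /= sub0r normrN.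
have g'0 : g' 0 = 0.
  have D0 : is_derive (0:R) (1:R) g 0.
    apply: (@derive1_at_max R g (- del) del 0).
    - lra.
    - by move=> t; rewrite in_itv /= => ht; have [] := (key' t ltac:(rewrite ltr_norml; lra)).1.
    - by rewrite in_itv /=; lra.
    - by move=> t; rewrite in_itv /= => ht; apply: (key' t ltac:(rewrite ltr_norml; lra)).2.
  have [_ e1] := D0; have [_ e2] := (key' 0 ltac:(by rewrite normr0)).1.
  by rewrite -e2 e1.
split => //; rewrite leNgt; apply/negP => g2p.
have : (fun h : R => h^-1 *: (g' h)) @ 0^' --> g2.
  have [D E] := d2; move: D E; rewrite /derivable /derive => /[swap] <- D.
  suff -> : (fun h : R => h^-1 *: g' h) =
    (fun h : R => h^-1 *: ((g' \o shift 0) (h *: (1:R)) - g' 0)) by [].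
  by apply/funext => h /=; rewrite g'0 subr0 addr0 [h *: 1]mulr1.
move=> /cvgrPdist_lt /(_ g2 g2p) /=.
rewrite near_withinE => /nbhs_ballP [del' /= del'0 key2].
have key2' t : 0 < t < del' -> 0 < g' t.
  move=> ht; have : ball (0:R) del' t.
    by rewrite -ball_normE /ball_ /= sub0r normrN ltr_norml; lra.
  move=> /key2 /(_ ltac:(rewrite gt_eqF //; lra)).
  rewrite /= ltr_norml => h.
  have : 0 < t^-1 *: g' t by lra.
  by rewrite pmulr_rgt0 // invr_gt0; lra.
set m := Num.min del del' / 2.
have m0 : 0 < m by rewrite /m divr_gt0 // lt_min del0.
have md : m < del.
  have : Num.min del del' <= del by rewrite ge_min lexx.
  by rewrite /m; lra.
have md' : m < del'.
  have : Num.min del del' <= del' by rewrite ge_min lexx orbT.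
  by rewrite /m; lra.
have dg t : 0 <= t <= m -> is_derive t (1:R) g (g' t).
  by move=> ht; apply: (key' t ltac:(rewrite ltr_norml; lra)).1.
have [||c] := @MVT R g g' 0 m m0.
- by move=> t; rewrite in_itv /= => ht; apply: dg; lra.
- by apply: derivable_within_continuous => t; rewrite in_itv /= => ht; have [] := dg t ht.
rewrite in_itv /= => hc E.
have := (key' m ltac:(rewrite ltr_norml; lra)).2.
have : 0 < g' c by apply: key2'; lra.
move=> p; have : 0 < g' c * (m - 0) by rewrite mulr_gt0 //; lra.
by rewrite -E; lra.
Qed.

(** Restrict F to the line through v directed by d and differentiate twice. *)
Lemma local_max_hessian F (F1 : 'I_2 -> 'rV[R]_2 -> R)
   (F2 : 'I_2 -> 'I_2 -> 'rV[R]_2 -> R) v d :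
  (forall k, \forall w \near v, is_derive w (axis k) F (F1 k w)) ->
  (forall k l, \forall w \near v, is_derive w (axis l) (F1 k) (F2 k l w)) ->
  (forall k, \forall w \near v, {for w, continuous (F1 k)}) ->
  (forall k l, {for v, continuous (F2 k l)}) ->
  (\forall w \near v, F w <= F v) ->
  d 0 0 * F1 0 v + d 0 1 * F1 1 v = 0 /\
  d 0 0 * (d 0 0 * F2 0 0 v + d 0 1 * F2 0 1 v) +
  d 0 1 * (d 0 0 * F2 1 0 v + d 0 1 * F2 1 1 v) <= 0.
Proof.
move=> h1 h2 c1 c2 mx.
have near1 : \forall w \near v, forall k, is_derive w (axis k) F (F1 k w) /\
    {for w, continuous (F1 k)}.
  have n0 : \forall w \near v, (is_derive w (axis 0) F (F1 0 w) /\ is_derive w (axis 1) F (F1 1 w)) /\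
     ({for w, continuous (F1 0)} /\ {for w, continuous (F1 1)}).
    exact: (filterI (filterI (h1 0) (h1 1)) (filterI (c1 0) (c1 1))).
  by apply: filterS n0 => w [[? ?] [? ?]] k; case: (I2P k) => ->.
have lineD : \forall w \near v, is_derive w d F (d 0 0 * F1 0 w + d 0 1 * F1 1 w).
  apply: filterS (nbhs_interior near1) => w hw; apply: is_derive_partial.
  - by apply: filterS hw => z /(_ 0) [].
  - by apply: filterS hw => z /(_ 1) [].
  - by have [] := nbhs_singleton hw 0.
  - by have [] := nbhs_singleton hw 1.
have cl : {for (0:R), continuous (fun t : R => v + t *: d)}.
  apply: continuousD; first exact: cst_continuous.
  by apply: (@continuousZl _ _ _ id d 0); exact: id.
have cl' (P : 'rV[R]_2 -> Prop) : (\forall w \near v, P w) -> \forall t \near (0:R), P (v + t *: d).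
  by move=> hP; apply: cl; rewrite /= scale0r addr0.
have [] := @local_max_deriv2 (fun t => F (v + t *: d))
   (fun t => d 0 0 * F1 0 (v + t *: d) + d 0 1 * F1 1 (v + t *: d))
   (d 0 0 * (d 0 0 * F2 0 0 v + d 0 1 * F2 0 1 v) +
  d 0 1 * (d 0 0 * F2 1 0 v + d 0 1 * F2 1 1 v)).
- by apply: filterS (cl' _ lineD) => t /is_derive_lineE.
- have line2 k : is_derive (0:R) (1:R) (fun t : R => F1 k (v + t *: d)) (d 0 0 * F2 k 0 v + d 0 1 * F2 k 1 v).
    apply/is_derive_lineE; rewrite scale0r addr0.
    by apply: is_derive_partial.
  by apply: is_deriveD; apply: is_deriveZ.
- by apply: filterS (cl' _ mx) => t; rewrite scale0r addr0.
by rewrite scale0r addr0.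
Qed.

End Lines.

(** * Calculus in a chart *)

(** The part of [riemannian_surface] that concerns one chart, so that the
    calculus applies to a chart of an open subset before this subset is known
    to be a surface. *)
Record good_chart (R : realType) (S : surface R) (i : chart S) : Prop := GoodChart {
  gc_open : open (dom i);
  gc_inj : forall x y : S, dom i x -> dom i y -> Defs.coord i x = Defs.coord i y -> x = y;
  gc_cont : forall x : S, dom i x -> {for x, continuous (Defs.coord i)};
  gc_openmap : forall V : set S, V `<=` dom i -> open V -> open (Defs.coord i @` V)
}.

(** Partial derivatives are used through an opaque copy [pd] of [pderiv]:
    otherwise comparing two of them up to conversion unfolds limits and the
    choice operator of [in_chart]. *)
Fact pd_seal : {pd : forall (R : realType) (S : surface R) (i : chart S),
   'I_2 -> (S -> R) -> S -> R | pd = @pderiv}.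
Proof. by exists @pderiv. Qed.

Definition pd := sval pd_seal.
Arguments pd {R S} i k f x.

Lemma pdE : @pd = @pderiv. Proof. exact: (svalP pd_seal). Qed.

Lemma sum2E (R : realType) (F : 'I_2 -> R) : \sum_k F k = F 0 + F 1.
Proof.
rewrite !big_ord_recl big_ord0 addr0; congr (F _ + F _); exact/val_inj.
Qed.

Section ChartCalculus.
Variables (R : realType) (S : surface R) (i : chart S).
Hypothesis gc : good_chart i.
Implicit Types (f g : S -> R) (x y : S) (W : set S).
Local Notation D := (dom i).
Local Notation c := (Defs.coord i).

Lemma in_chartE f x : D x -> in_chart i f (c x) = f x.
Proof.
move=> Dx; rewrite /in_chart; case: xgetP => [y _ [z [Dz /= cz] <-]|/(_ (f x)) []].
  by rewrite (gc_inj gc Dz Dx cz).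
by exists x.
Qed.

Lemma in_chart_out f v : ~ (exists2 x, D x & c x = v) -> in_chart i f v = 0.
Proof.
move=> H; rewrite /in_chart; case: xgetP => // y _ [z [Dz /= cz] _].
by case: H; exists z.
Qed.

(** Outside the image of the chart both sides are 0, hence op 0 0 = 0. *)
Lemma in_chart_op2 (op : R -> R -> R) f g : op 0 0 = 0 ->
  in_chart i (fun x => op (f x) (g x)) =
  (fun v => op (in_chart i f v) (in_chart i g v)).
Proof.
move=> op0; apply/funext => v.
have [[x Dx <-]|H] := pselect (exists2 x, D x & c x = v).
  by rewrite !in_chartE.
by rewrite !in_chart_out.
Qed.

Lemma near_chart x (P : set S) : D x -> nbhs x P ->
  \forall v \near c x, exists y, [/\ D y, c y = v & P y].
Proof.
move=> Dx; rewrite nbhsE => -[V [oV Vx] VP].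
have oVD : open (V `&` D) by apply: openI => //; exact: gc_open gc.
have oc := gc_openmap gc (@subIsetr _ V D) oVD.
have : nbhs (c x) (c @` (V `&` D)).
  by apply: open_nbhs_nbhs; split=> //; exists x.
by apply: filterS => v [y [Vy Dy] <-]; exists y; split=> //; exact: VP.
Qed.

Lemma near_dom x : D x -> \forall y \near x, D y.
Proof. by move=> Dx; apply: open_nbhs_nbhs; split => //; exact: gc_open gc. Qed.

Lemma in_chart_continuous f x : D x -> {for x, continuous f} ->
  {for c x, continuous (in_chart i f)}.
Proof.
move=> Dx cf A; rewrite /= in_chartE // => /cf /= H.
by apply: filterS (near_chart Dx H) => v [y [Dy <- ?]]; rewrite /= in_chartE.
Qed.

Lemma near_eq_in_chart f g x : D x -> (\forall y \near x, f y = g y) ->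
  \forall v \near c x, in_chart i f v = in_chart i g v.
Proof.
move=> Dx H; apply: filterS (near_chart Dx H) => v [y [Dy <- E]].
by rewrite !in_chartE.
Qed.

Definition has_pd f x (df : 'I_2 -> R) :=
  forall k, is_derive (c x) (axis k : 'rV[R]_2) (in_chart i f) (df k).

Lemma has_pdE f x df : has_pd f x df -> forall k, pd i k f x = df k.
Proof. rewrite pdE; by move=> H k; have [] := H k. Qed.

Lemma has_pd_eq f x df df' : has_pd f x df -> df =1 df' -> has_pd f x df'.
Proof. by move=> H E k; rewrite -E. Qed.

Lemma has_pd_near f g x df : D x -> (\forall y \near x, f y = g y) ->
  has_pd f x df -> has_pd g x df.
Proof.
by move=> Dx /(near_eq_in_chart Dx) E H k; exact: near_eq_is_derive E (H k).
Qed.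

Lemma pd_near k f g x : D x -> (\forall y \near x, f y = g y) ->
  pd i k f x = pd i k g x.
Proof. by rewrite pdE => Dx /(near_eq_in_chart Dx) E; exact: near_eq_derive E. Qed.

Lemma has_pd_cst r x : D x -> has_pd (fun=> r) x (fun=> 0).
Proof.
move=> Dx k.
apply: near_eq_is_derive (is_derive_cst (r : R) (c x) (axis k : 'rV[R]_2)).
apply: filterS (near_chart Dx (near_dom Dx)) => v [y [Dy <- _]].
by rewrite in_chartE.
Qed.

Lemma has_pdD f g x df dg : has_pd f x df -> has_pd g x dg ->
  has_pd (fun y => f y + g y) x (fun k => df k + dg k).
Proof.
move=> Hf Hg k; rewrite (@in_chart_op2 (fun a b => a + b)) ?addr0 //.
exact: is_deriveD.
Qed.

Lemma has_pdM f g x df dg : D x -> has_pd f x df -> has_pd g x dg ->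
  has_pd (fun y => f y * g y) x (fun k => f x * dg k + df k * g x).
Proof.
move=> Dx Hf Hg k; rewrite (@in_chart_op2 (fun a b => a * b)) ?mulr0 //.
have := is_deriveM (Hf k) (Hg k); rewrite !in_chartE //.
by rewrite [df k * _]mulrC.
Qed.

Lemma has_pd_comp (phi : R -> R) f x df r : D x ->
  is_derive (f x) (1:R) phi r -> has_pd f x df ->
  has_pd (fun y => phi (f y)) x (fun k => r * df k).
Proof.
move=> Dx Hphi Hf k.
apply: (@near_eq_is_derive _ _ _ (fun v => phi (in_chart i f v))).
  apply: filterS (near_chart Dx (near_dom Dx)) => v [y [Dy <- _]].
  by rewrite !in_chartE.
have : is_derive (c x + (0:R) *: axis k) (axis k : 'rV[R]_2) (in_chart i f) (df k).
  by rewrite scale0r addr0.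
move=> /is_derive_lineE H1.
have H2 : is_derive (in_chart i f (c x + (0:R) *: axis k)) (1:R) phi r.
  by rewrite scale0r addr0 in_chartE.
have := @is_derive1_comp _ phi _ _ _ _ H2 H1.
move=> /(is_derive_lineE (fun v => phi (in_chart i f v))).
by rewrite scale0r addr0.
Qed.

Lemma smooth_inP W f : smooth_in i W f <->
  forall (s : seq 'I_2) x, W x -> {for x, continuous (foldr (pd i) f s)} /\
    forall k, derivable (in_chart i (foldr (pd i) f s)) (c x) (axis k : 'rV[R]_2).
Proof. by rewrite pdE. Qed.

Lemma smooth_in_sub W W' f : W' `<=` W -> smooth_in i W f -> smooth_in i W' f.
Proof. by move=> sW H s x /sW; exact: H. Qed.

Lemma smooth_in_pderiv W f k : smooth_in i W f -> smooth_in i W (pd i k f).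
Proof. by move=> H s x Wx; have := H (rcons s k) x Wx; rewrite foldr_rcons pdE. Qed.

Lemma smooth_in_continuous W f x : smooth_in i W f -> W x -> {for x, continuous f}.
Proof. by move=> H Wx; have [] := H [::] x Wx. Qed.

Lemma smooth_in_has_pd W f x : smooth_in i W f -> W x ->
  has_pd f x (fun k => pd i k f x).
Proof. by move=> H Wx k; rewrite pdE; apply/derivableP; have [_] := H [::] x Wx; exact. Qed.

(** The functions built from smooth ones by the operations used below.  The
    partial derivatives of such an expression are again expressions, so that
    one order of differentiability entails all of them. *)
Inductive smooth_expr W : (S -> R) -> Prop :=
| SmoothGen f : smooth_in i W f -> smooth_expr W f
| SmoothCst r : smooth_expr W (fun=> r)
| SmoothAdd f g : smooth_expr W f -> smooth_expr W g ->
    smooth_expr W (fun x => f x + g x)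
| SmoothMul f g : smooth_expr W f -> smooth_expr W g ->
    smooth_expr W (fun x => f x * g x)
| SmoothInv f : (forall x, W x -> f x != 0) -> smooth_expr W f ->
    smooth_expr W (fun x => (f x)^-1)
| SmoothLn f : (forall x, W x -> 0 < f x) -> smooth_expr W f ->
    smooth_expr W (fun x => ln (f x))
| SmoothExp f : smooth_expr W f -> smooth_expr W (fun x => expR (f x)).

Section OpenSubset.
Variable W : set S.
Hypotheses (oW : open W) (WD : W `<=` D).

Lemma near_W x : W x -> \forall y \near x, W y.
Proof. by move=> Wx; apply: open_nbhs_nbhs. Qed.

Lemma is_derive_inv (r : R) : r != 0 -> is_derive r (1:R) (fun t : R => t^-1) (- r ^- 2).
Proof.
move=> r0; have := @is_deriveV R id r 1 1 r0 (is_derive_id _ _).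
by rewrite [_ *: 1]mulr1.
Qed.

Lemma smooth_expr_step f : smooth_expr W f ->
  (forall x, W x -> {for x, continuous f}) /\
  exists df : 'I_2 -> S -> R, (forall k, smooth_expr W (df k)) /\
    forall x, W x -> has_pd f x (df ^~ x).
Proof.
elim=> {f} [f Hf|r|f g _ [cf [df [sf pf]]] _ [cg [dg [sg pg]]]
  |f g Hf [cf [df [sf pf]]] Hg [cg [dg [sg pg]]]
  |f f0 Hf [cf [df [sf pf]]]|f f0 Hf [cf [df [sf pf]]]|f Hf [cf [df [sf pf]]]].
- split=> [x Wx|]; first exact: smooth_in_continuous Hf Wx.
  exists (fun k => pd i k f); split => [k|x Wx].
    by apply: SmoothGen; exact: smooth_in_pderiv.
  exact: smooth_in_has_pd Hf Wx.
- split=> [x Wx|]; first exact: cst_continuous.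
  exists (fun _ _ => 0); split => [k|x Wx]; first exact: SmoothCst.
  exact: has_pd_cst (WD Wx).
- split=> [x Wx|]; first by apply: continuousD; [exact: cf|exact: cg].
  exists (fun k x => df k x + dg k x); split => [k|x Wx]; first exact: SmoothAdd.
  exact: has_pdD (pf _ Wx) (pg _ Wx).
- split=> [x Wx|]; first by apply: continuousM; [exact: cf|exact: cg].
  exists (fun k x => f x * dg k x + df k x * g x); split => [k|x Wx].
    by apply: SmoothAdd; apply: SmoothMul.
  exact: has_pdM (WD Wx) (pf _ Wx) (pg _ Wx).
- split=> [x Wx|]; first by apply: continuousV; [exact: f0|exact: cf].
  exists (fun k x => (- 1) * ((f x)^-1 * (f x)^-1) * df k x); split => [k|x Wx].
    apply: SmoothMul => //; apply: SmoothMul; first exact: SmoothCst.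
    by apply: SmoothMul; apply: SmoothInv.
  apply: has_pd_eq (has_pd_comp (WD Wx) (is_derive_inv (f0 _ Wx)) (pf _ Wx)) _ => k.
  by rewrite expr2 invfM mulN1r.
- split=> [x Wx|].
    apply: continuous_comp; first exact: cf.
    by apply: continuous_ln; exact: f0.
  exists (fun k x => (f x)^-1 * df k x); split => [k|x Wx].
    apply: SmoothMul => //; apply: SmoothInv => // x Wx.
    by rewrite gt_eqF // f0.
  exact: has_pd_comp (WD Wx) (is_derive1_ln (f0 _ Wx)) (pf _ Wx).
- split=> [x Wx|].
    by apply: continuous_comp; [exact: cf|exact: continuous_expR].
  exists (fun k x => expR (f x) * df k x); split => [k|x Wx].
    by apply: SmoothMul => //; apply: SmoothExp.
  exact: has_pd_comp (WD Wx) (is_derive_expR _) (pf _ Wx).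
Qed.

(** By induction on the number of derivatives: each iterated derivative of an
    expression coincides on W with an expression. *)
Lemma smooth_expr_in f : smooth_expr W f -> smooth_in i W f.
Proof.
move=> Hf; apply/smooth_inP => s.
suff [g [Hg Eg]] : exists g, smooth_expr W g /\ forall x, W x -> foldr (pd i) f s x = g x.
  move=> x Wx; have [cg [dg [_ pg]]] := smooth_expr_step Hg.
  have E : \forall y \near x, g y = foldr (pd i) f s y.
    by apply: filterS (near_W Wx) => y Wy; rewrite Eg.
  split.
    move=> A; rewrite /= Eg // => /(cg x Wx) /= H.
    suff: \forall y \near x, A (foldr (pd i) f s y) by [].
    have {}H : \forall y \near x, A (g y) by exact: H.
    by apply: filterS2 H E => y + <-.
  by move=> k; have [] := has_pd_near (WD Wx) E (pg x Wx) k.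
elim: s => [|k s [g [Hg Eg]]]; first by exists f.
have [_ [dg [Hdg pg]]] := smooth_expr_step Hg; exists (dg k); split => // x Wx /=.
rewrite (@pd_near k _ g) ?(has_pdE (pg x Wx)) //; first exact: WD.
by apply: filterS (near_W Wx) => y; exact: Eg.
Qed.

Lemma smooth_in_eq f g : (forall x, W x -> f x = g x) ->
  smooth_in i W f -> smooth_in i W g.
Proof.
move=> E /smooth_inP H; apply/smooth_inP => s x Wx.
have Es y : W y -> foldr (pd i) g s y = foldr (pd i) f s y.
  elim: s y => [|k s IH] y Wy /=; first by rewrite E.
  apply: pd_near; first exact: WD.
  by apply: filterS (near_W Wy) => z; exact: IH.
have [cf df] := H s x Wx.
have Eq : \forall y \near x, foldr (pd i) f s y = foldr (pd i) g s y.
  by apply: filterS (near_W Wx) => y Wy; rewrite Es.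
split.
  move=> A; rewrite /= Es // => /cf /= h.
  suff: \forall y \near x, A (foldr (pd i) g s y) by [].
  have {}h : \forall y \near x, A (foldr (pd i) f s y) by exact: h.
  by apply: filterS2 h Eq => y + <-.
move=> k; apply: near_eq_derivable (df k).
exact: near_eq_in_chart (WD Wx) Eq.
Qed.

Lemma smooth_in_cst r : smooth_in i W (fun=> r).
Proof. exact/smooth_expr_in/SmoothCst. Qed.

Lemma smooth_inD f g : smooth_in i W f -> smooth_in i W g ->
  smooth_in i W (fun x => f x + g x).
Proof. by move=> Hf Hg; apply/smooth_expr_in/SmoothAdd; exact: SmoothGen. Qed.

Lemma smooth_inM f g : smooth_in i W f -> smooth_in i W g ->
  smooth_in i W (fun x => f x * g x).
Proof. by move=> Hf Hg; apply/smooth_expr_in/SmoothMul; exact: SmoothGen. Qed.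

Lemma smooth_inV f : (forall x, W x -> f x != 0) -> smooth_in i W f ->
  smooth_in i W (fun x => (f x)^-1).
Proof. by move=> f0 Hf; apply/smooth_expr_in/SmoothInv => //; exact: SmoothGen. Qed.

Lemma smooth_in_ln f : (forall x, W x -> 0 < f x) -> smooth_in i W f ->
  smooth_in i W (fun x => ln (f x)).
Proof. by move=> f0 Hf; apply/smooth_expr_in/SmoothLn => //; exact: SmoothGen. Qed.

Lemma smooth_in_exp f : smooth_in i W f -> smooth_in i W (fun x => expR (f x)).
Proof. by move=> Hf; apply/smooth_expr_in/SmoothExp => //; exact: SmoothGen. Qed.

Lemma smooth_inN f : smooth_in i W f -> smooth_in i W (fun x => - f x).
Proof.
move=> Hf; apply: smooth_in_eq (smooth_inM (smooth_in_cst (-1)) Hf) => x _.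
by rewrite mulN1r.
Qed.

Lemma smooth_inB f g : smooth_in i W f -> smooth_in i W g ->
  smooth_in i W (fun x => f x - g x).
Proof. by move=> Hf Hg; exact: (smooth_inD Hf (smooth_inN Hg)). Qed.

Lemma pdC f k l x : smooth_in i W f -> W x ->
  pd i k (pd i l f) x = pd i l (pd i k f) x.
Proof.
move=> Hf Wx; have Dx := WD Wx.
have nW : \forall v \near c x, exists y, [/\ D y, c y = v & W y].
  by apply: near_chart => //; exact: near_W.
have near_pd g m : smooth_in i W g -> \forall v \near c x,
    is_derive v (axis m : 'rV[R]_2) (in_chart i g) (in_chart i (pd i m g) v).
  move=> Hg; apply: filterS nW => v [y [Dy <- Wy]].
  by rewrite in_chartE //; exact: smooth_in_has_pd Hg Wy _.
have cont g : smooth_in i W g -> {for c x, continuous (in_chart i g)}.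
  by move=> Hg; apply: in_chart_continuous => //; exact: smooth_in_continuous Hg Wx.
have sp m g := @smooth_in_pderiv W g m.
rewrite -[LHS](in_chartE _ Dx) -[RHS](in_chartE _ Dx).
exact: (schwarz (near_pd f l Hf) (near_pd f k Hf)
  (near_pd _ k (sp l f Hf)) (near_pd _ l (sp k f Hf))
  (cont _ (sp k _ (sp l f Hf))) (cont _ (sp l _ (sp k f Hf)))).
Qed.

Lemma local_max_pd f x (d : 'I_2 -> R) : smooth_in i W f -> W x ->
  (\forall y \near x, f y <= f x) ->
  d 0 * pd i 0 f x + d 1 * pd i 1 f x = 0 /\
  d 0 * (d 0 * pd i 0 (pd i 0 f) x + d 1 * pd i 1 (pd i 0 f) x) +
  d 1 * (d 0 * pd i 0 (pd i 1 f) x + d 1 * pd i 1 (pd i 1 f) x) <= 0.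
Proof.
move=> Hf Wx mx; have Dx := WD Wx.
have nW : \forall v \near c x, exists y, [/\ D y, c y = v & W y].
  by apply: near_chart => //; exact: near_W.
have near_pd g m : smooth_in i W g -> \forall v \near c x,
    is_derive v (axis m : 'rV[R]_2) (in_chart i g) (in_chart i (pd i m g) v).
  move=> Hg; apply: filterS nW => v [y [Dy <- Wy]].
  by rewrite in_chartE //; exact: smooth_in_has_pd Hg Wy _.
have cont g y : smooth_in i W g -> W y -> {for c y, continuous (in_chart i g)}.
  move=> Hg Wy; apply: in_chart_continuous; first exact: WD.
  exact: smooth_in_continuous Hg Wy.
have sp m g := @smooth_in_pderiv W g m.
have [] := @local_max_hessian _ (in_chart i f) (fun k => in_chart i (pd i k f))
  (fun k l => in_chart i (pd i l (pd i k f))) (c x) (\row_j d j).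
- by move=> k; exact: near_pd.
- by move=> k l; apply: near_pd; exact: sp.
- move=> k; apply: filterS nW => v [y [_ <- Wy]].
  exact: (cont _ _ (sp k f Hf) Wy).
- by move=> k l; exact: (cont _ _ (sp l _ (sp k f Hf)) Wx).
- apply: filterS (near_chart Dx mx) => v [y [Dy <- E]].
  by rewrite !in_chartE.
by rewrite !mxE !(in_chartE _ Dx).
Qed.

End OpenSubset.
End ChartCalculus.

(** * The metric in a chart: Christoffel symbols and Laplacian *)

(** The part of [riemannian_surface] that concerns the metric in one chart. *)
Record good_metric (R : realType) (S : surface R) (i : chart S) : Prop := GoodMetric {
  gm_chart :> good_chart i;
  gm_smooth : forall k l, smooth_in i (dom i) (fun x => metric i x k l);
  gm_sym : forall x, dom i x -> (metric i x)^T = metric i x;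
  gm_pos : forall x (v : 'rV[R]_2), dom i x -> v != 0 ->
    0 < (v *m metric i x *m v^T) 0 0
}.

Lemma has_pd_ext (R : realType) (S : surface R) (i : chart S) (gc : good_chart i)
  (f g : S -> R) x df df' : dom i x -> has_pd i f x df ->
  (\forall y \near x, f y = g y) -> df =1 df' -> has_pd i g x df'.
Proof. by move=> Dx Hf Efg Ed; exact: (has_pd_near gc Dx Efg (has_pd_eq Hf Ed)). Qed.

Section TwoByTwo.
Variable R : realType.
Lemma det2E (A : 'M[R]_2) : \det A = A 0 0 * A 1 1 - A 0 1 * A 1 0.
Proof.
rewrite (expand_det_row _ 0) sum2E /cofactor !det_mx11 !mxE /=.
have -> : lift 0 0 = 1 :> 'I_2 by exact/val_inj.
have -> : lift 1 0 = 0 :> 'I_2 by exact/val_inj.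
by rewrite expr0 expr1 mul1r mulN1r mulrN.
Qed.

Lemma invmx2E (A : 'M[R]_2) : \det A != 0 ->
  [/\ invmx A 0 0 = A 1 1 / \det A, invmx A 0 1 = - A 0 1 / \det A,
      invmx A 1 0 = - A 1 0 / \det A & invmx A 1 1 = A 0 0 / \det A].
Proof.
move=> d0.
set B := \matrix_(k, l) (if k == 0 then (if l == 0 then A 1 1 / \det A else - A 0 1 / \det A)
  else (if l == 0 then - A 1 0 / \det A else A 0 0 / \det A)) : 'M[R]_2.
have AB : A *m B = 1%:M.
  apply/matrixP => k l; rewrite !mxE sum2E !mxE /=.
  by case: (I2P k) => ->; case: (I2P l) => ->; rewrite /=; move: d0; rewrite det2E => d0; field.
have u : A \in unitmx by rewrite unitmxE unitfE.
have -> : invmx A = B by rewrite -[B]mul1mx -(mulVmx u) -mulmxA AB mulmx1.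
by rewrite !mxE.
Qed.
End TwoByTwo.

Section Components.
Variables (R : realType) (S : surface R) (i : chart S).
Implicit Types (f : S -> R) (x : S) (k l n : 'I_2).

Definition mcomp k l : S -> R := fun y => metric i y k l.

(** The determinant of a symmetric metric. *)
Definition mdet : S -> R :=
  fun y => mcomp 0 0 y * mcomp 1 1 y - mcomp 0 1 y * mcomp 0 1 y.

Definition minv k l : S -> R := fun y => inv_metric i y k l.

Definition dmetric n k l : S -> R := pd i n (mcomp k l).

(** The covariant Hessian: its trace with respect to the metric is the Laplacian. *)
Definition hessian f k l x : R := pd i k (pd i l f) x -
  (christoffel i 0 k l x * pd i 0 f x + christoffel i 1 k l x * pd i 1 f x).

(** The squared norm of the gradient, as a quadratic form in the differential. *)
Definition sqgrad f x : R :=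
  minv 0 0 x * pd i 0 f x ^+ 2 + 2 * minv 0 1 x * pd i 0 f x * pd i 1 f x
  + minv 1 1 x * pd i 1 f x ^+ 2.
End Components.

(** [ring] and [field] compare their atoms up to conversion; variables make
    this immediate. *)
Ltac generalize_atoms := repeat match goal with
  | |- context [christoffel ?i ?k ?l ?m ?x] => generalize (christoffel i k l m x); let a := fresh "a" in intro a
  | |- context [mcomp ?i ?k ?l ?x] => generalize (mcomp i k l x); let a := fresh "a" in intro a
  | |- context [dmetric ?i ?n ?k ?l ?x] => generalize (dmetric i n k l x); let a := fresh "a" in intro a
  | |- context [minv ?i ?k ?l ?x] => generalize (minv i k l x); let a := fresh "a" in intro a
  | |- context [pd ?i ?k ?f ?x] => generalize (pd i k f x); let a := fresh "a" in intro a
  end.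

Section Metric.
Variables (R : realType) (S : surface R) (i : chart S).
Hypothesis gm : good_metric i.
Implicit Types (f : S -> R) (x y : S) (k l m n p q : 'I_2).
Local Notation D := (dom i).
Local Notation c := (Defs.coord i).
Local Notation gcomp := (mcomp i).
Local Notation gdet := (mdet i).
Local Notation ginv := (minv i).
Local Notation gd := (dmetric i).
Local Notation hess := (hessian i).
Let gc : good_chart i := gm.
Let oD : open D := gc_open gc.
Let DD : D `<=` D := @subset_refl _ D.

Lemma mcomp_sym k l x : D x -> gcomp k l x = gcomp l k x.
Proof. by move=> Dx; rewrite /mcomp -{1}(gm_sym gm Dx) mxE. Qed.

Lemma mdetE x : D x -> \det (metric i x) = gdet x.
Proof. by move=> Dx; rewrite det2E /mdet -{2}(mcomp_sym 1 0 Dx). Qed.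

Lemma mcomp00_gt0 x : D x -> 0 < gcomp 0 0 x.
Proof.
move=> Dx; have := @gm_pos _ _ _ gm x (\row_j (if j == 0 then 1 else 0)) Dx.
rewrite !(mxE, sum2E) /= !(mul1r, mul0r, mulr0, mulr1, addr0, add0r); apply.
apply/eqP => /rowP /(_ 0); rewrite !mxE /= => /eqP; by rewrite oner_eq0.
Qed.

(** The metric evaluated on (- g01, g00) is g00 times its determinant. *)
Lemma mdet_gt0 x : D x -> 0 < gdet x.
Proof.
move=> Dx; have E0 := mcomp00_gt0 Dx.
have := @gm_pos _ _ _ gm x (\row_j (if j == 0 then - gcomp 0 1 x else gcomp 0 0 x)) Dx.
rewrite !(mxE, sum2E) /=.
rewrite -/(gcomp 0 0 x) -/(gcomp 0 1 x) -/(gcomp 1 0 x) -/(gcomp 1 1 x).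
rewrite (mcomp_sym 1 0 Dx) => H.
have : 0 < gcomp 0 0 x * gdet x.
  have -> : gcomp 0 0 x * gdet x =
    (- gcomp 0 1 x * gcomp 0 0 x + gcomp 0 0 x * gcomp 0 1 x) * - gcomp 0 1 x +
    (- gcomp 0 1 x * gcomp 0 1 x + gcomp 0 0 x * gcomp 1 1 x) * gcomp 0 0 x.
    by rewrite /mdet; ring.
  apply: H; apply/eqP => /rowP /(_ 1); rewrite !mxE /= => E.
  by move: E0; rewrite E ltxx.
by rewrite pmulr_rgt0.
Qed.

Lemma mdet_neq0 x : D x -> gdet x != 0.
Proof. by move=> /mdet_gt0 H; rewrite gt_eqF. Qed.

Lemma minvE x : D x ->
  [/\ ginv 0 0 x = gcomp 1 1 x / gdet x, ginv 0 1 x = - gcomp 0 1 x / gdet x,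
      ginv 1 0 x = - gcomp 0 1 x / gdet x & ginv 1 1 x = gcomp 0 0 x / gdet x].
Proof.
move=> Dx; have [] := @invmx2E _ (metric i x).
  by rewrite mdetE // mdet_neq0.
rewrite /minv /inv_metric -(mdetE Dx) => -> -> -> ->; split => //.
by rewrite -/(gcomp 1 0 x) mcomp_sym.
Qed.

Lemma smooth_mcomp k l : smooth_in i D (gcomp k l).
Proof. exact: gm_smooth. Qed.

Lemma smooth_mdet : smooth_in i D gdet.
Proof.
apply: (smooth_inB gc oD DD); apply: (smooth_inM gc oD DD); exact: smooth_mcomp.
Qed.

Lemma smooth_mdetV : smooth_in i D (fun y => (gdet y)^-1).
Proof. by apply: (smooth_inV gc oD DD) smooth_mdet => x; exact: mdet_neq0. Qed.

Lemma smooth_minv k l : smooth_in i D (ginv k l).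
Proof.
have H f : smooth_in i D f -> smooth_in i D (fun y => f y / gdet y).
  by move=> Hf; apply: (smooth_inM gc oD DD) Hf smooth_mdetV.
have HN := smooth_inN gc oD DD (smooth_mcomp 0 1).
case: (I2P k) => ->; case: (I2P l) => ->.
- by apply: (smooth_in_eq gc oD DD) (H _ (smooth_mcomp 1 1)) => x /minvE [].
- by apply: (smooth_in_eq gc oD DD) (H _ HN) => x /minvE [].
- by apply: (smooth_in_eq gc oD DD) (H _ HN) => x /minvE [].
- by apply: (smooth_in_eq gc oD DD) (H _ (smooth_mcomp 0 0)) => x /minvE [].
Qed.

Lemma dmetric_sym n k l x : D x -> gd n k l x = gd n l k x.
Proof.
move=> Dx; apply: (pd_near gc) => //.
by apply: filterS (near_dom gc Dx) => y; exact: mcomp_sym.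
Qed.

Local Notation Gam := (christoffel i).

Lemma christoffelE k l m x :
  Gam k l m x = 2^-1 * (ginv k 0 x * (gd l m 0 x + gd m l 0 x - gd 0 l m x) +
                        ginv k 1 x * (gd l m 1 x + gd m l 1 x - gd 1 l m x)).
Proof. by rewrite /christoffel sum2E /dmetric pdE. Qed.

Lemma christoffel_sym k l m x : D x -> Gam k l m x = Gam k m l x.
Proof.
move=> Dx; rewrite !christoffelE (dmetric_sym 0 l m Dx) (dmetric_sym 1 l m Dx).
by congr (_ * (_ * _ + _ * _)); congr (_ - _); rewrite addrC.
Qed.

Lemma smooth_christoffel k l m : smooth_in i D (Gam k l m).
Proof.
have sgd a b d : smooth_in i D (gd a b d) by apply/smooth_in_pderiv/smooth_mcomp.
have T p : smooth_in i D (fun x => ginv k p x * (gd l m p x + gd m l p x - gd p l m x)).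
  apply: (smooth_inM gc oD DD); first exact: smooth_minv.
  by apply: (smooth_inB gc oD DD) => //; apply: (smooth_inD gc oD DD).
apply: (smooth_in_eq gc oD DD) (smooth_inM gc oD DD (smooth_in_cst gc oD DD 2^-1) (smooth_inD gc oD DD (T 0) (T 1))).
by move=> x _; rewrite christoffelE.
Qed.

(** The Levi-Civita connection preserves the metric.  This trades the first
    derivatives of the metric for Christoffel symbols without any division,
    which keeps the identities below small. *)
Lemma dmetricE n l m x : D x ->
  gd n l m x = gcomp 0 m x * Gam 0 n l x + gcomp 1 m x * Gam 1 n l x +
               gcomp l 0 x * Gam 0 n m x + gcomp l 1 x * Gam 1 n m x.
Proof.
move=> Dx; rewrite !christoffelE.
have [-> -> -> ->] := minvE Dx.
have := mdet_neq0 Dx.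
case: (I2P n) => ->; case: (I2P l) => ->; case: (I2P m) => ->;
  rewrite ?(dmetric_sym _ 1 0 Dx) ?(mcomp_sym 1 0 Dx) /mdet => d0; by field.
Qed.

Lemma pd_mdet n x : D x ->
  pd i n gdet x = 2 * gdet x * (Gam 0 n 0 x + Gam 1 n 1 x).
Proof.
move=> Dx.
have P k l : has_pd i (gcomp k l) x (fun m => gd m k l x).
  exact: smooth_in_has_pd (smooth_mcomp k l) Dx.
have Q : has_pd i (fun y => - (gcomp 0 1 y * gcomp 0 1 y)) x (fun m =>
    - (gcomp 0 1 x * gd m 0 1 x + gd m 0 1 x * gcomp 0 1 x)).
  apply: (has_pd_ext gc Dx (has_pdM gc Dx (has_pd_cst gc (-1) Dx)
    (has_pdM gc Dx (P 0 1) (P 0 1)))).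
    by apply: filterS (near_dom gc Dx) => y _; rewrite mulN1r.
  by move=> k; rewrite mul0r addr0 mulN1r.
rewrite (has_pdE (has_pdD gc (has_pdM gc Dx (P 0 0) (P 1 1)) Q)).
rewrite !(dmetricE _ _ _ Dx) !(mcomp_sym 1 0 Dx) /mdet.
case: (I2P n) => ->; rewrite ?(christoffel_sym _ 1 0 Dx); generalize_atoms; ring.
Qed.

(** The inverse metric is preserved by the connection as well. *)
Lemma pd_minv n k l x : D x ->
  pd i n (ginv k l) x = - (Gam k n 0 x * ginv 0 l x + Gam k n 1 x * ginv 1 l x +
                           Gam l n 0 x * ginv k 0 x + Gam l n 1 x * ginv k 1 x).
Proof.
move=> Dx.
have P a b : has_pd i (gcomp a b) x (fun m => gd m a b x).
  exact: smooth_in_has_pd (smooth_mcomp a b) Dx.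
have Pd : has_pd i gdet x (fun m => pd i m gdet x) by exact: smooth_in_has_pd smooth_mdet Dx.
have Pi := has_pd_comp gc Dx (is_derive_inv (mdet_neq0 Dx)) Pd.
have Q f df (s : R) : has_pd i f x df ->
    pd i n (fun y => s * f y / gdet y) x =
    s * (df n / gdet x - f x * pd i n gdet x / gdet x ^+ 2).
  move=> Hf; rewrite (has_pdE (has_pdM gc Dx (has_pdM gc Dx (has_pd_cst gc s Dx) Hf) Pi)).
  by rewrite mul0r addr0; have := mdet_neq0 Dx; move: (gdet x) => d d0; field.
have {}Q k' l' a b s : (forall y, D y -> ginv k' l' y = s * gcomp a b y / gdet y) ->
    pd i n (ginv k' l') x =
    s * (gd n a b x / gdet x - gcomp a b x * pd i n gdet x / gdet x ^+ 2).
  move=> H; rewrite -(Q _ _ _ (P a b)); apply: (pd_near gc _ Dx).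
  by apply: filterS (near_dom gc Dx) => y; exact: H.
have [i1 i2 i3 i4] := minvE Dx; have := mdet_neq0 Dx.
case: (I2P k) => ->; case: (I2P l) => ->;
 [rewrite (Q _ _ 1 1 1)|rewrite (Q _ _ 0 1 (-1))|rewrite (Q _ _ 0 1 (-1))|rewrite (Q _ _ 0 0 1)];
 try by move=> y /minvE [? ? ? ?]; rewrite ?mul1r ?mulN1r.
all: rewrite (pd_mdet n Dx) !(dmetricE _ _ _ Dx).
all: rewrite ?i1 ?i2 ?i3 ?i4 ?(mcomp_sym 1 0 Dx) /mdet.
all: case: (I2P n) => ->; rewrite ?(christoffel_sym _ 1 0 Dx).
all: by generalize_atoms => d0; field.
Qed.

Lemma volE x : D x -> vol i x = Num.sqrt (gdet x).
Proof. by move=> Dx; rewrite /vol mdetE. Qed.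

(** The logarithmic derivative of the volume density is a trace of Christoffel
    symbols; in the divergence it cancels one part of the derivative of the
    inverse metric ([pd_minv]). *)
Lemma has_pd_vol x : D x ->
  has_pd i (vol i) x (fun n => vol i x * (Gam 0 n 0 x + Gam 1 n 1 x)).
Proof.
move=> Dx.
have Pd : has_pd i gdet x (fun m => pd i m gdet x) by exact: smooth_in_has_pd smooth_mdet Dx.
apply: (has_pd_ext gc Dx (has_pd_comp gc Dx (is_derive1_sqrt (mdet_gt0 Dx)) Pd)).
  by apply: filterS (near_dom gc Dx) => y /volE ->.
move=> k; rewrite (pd_mdet k Dx) volE //.
have s2 : gdet x = Num.sqrt (gdet x) * Num.sqrt (gdet x).
  by rewrite -expr2 sqr_sqrtr // ltW // mdet_gt0.
have s0 : Num.sqrt (gdet x) != 0 by rewrite gt_eqF // sqrtr_gt0 mdet_gt0.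
move: s2 s0; set s := Num.sqrt _ => s2 s0; rewrite {1}s2; move: s0.
by generalize_atoms => s_neq0; field.
Qed.

Lemma laplacianE W f x : open W -> W `<=` D -> smooth_in i W f -> W x ->
  laplacian i f x = ginv 0 0 x * hess f 0 0 x + ginv 0 1 x * hess f 0 1 x +
    (ginv 1 0 x * hess f 1 0 x + ginv 1 1 x * hess f 1 1 x).
Proof.
move=> oW WD Hf Wx; have Dx := WD _ Wx.
have gradE k : (fun y => vol i y * grad i f y k) =
   (fun y => vol i y * (ginv k 0 y * pd i 0 f y + ginv k 1 y * pd i 1 f y)).
  by apply/funext => y; rewrite /grad sum2E pdE.
have P k l := smooth_in_has_pd (smooth_minv k l) Dx.
have Pf l := smooth_in_has_pd (smooth_in_pderiv l Hf) Wx.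
have T k l := has_pdM gc Dx (P k l) (Pf l).
have TT k := has_pdM gc Dx (has_pd_vol Dx) (has_pdD gc (T k 0) (T k 1)).
rewrite /laplacian /divergence sum2E !gradE.
have v0 : vol i x != 0 by rewrite volE // gt_eqF // sqrtr_gt0 mdet_gt0.
rewrite -pdE (has_pdE (TT 0)) (has_pdE (TT 1)) /hessian.
rewrite !(pd_minv _ _ _ Dx).
have gs : ginv 1 0 x = ginv 0 1 x by have [_ -> -> _] := minvE Dx.
rewrite gs ?(christoffel_sym _ 1 0 Dx); move: v0; move: (vol i x).
by generalize_atoms => vx vx0; field.
Qed.

Lemma sq_norm_gradE f x : D x -> sq_norm i (grad i f x) x = sqgrad i f x.
Proof.
move=> Dx.
have gradE k : grad i f x k = ginv k 0 x * pd i 0 f x + ginv k 1 x * pd i 1 f x.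
  by rewrite /grad sum2E pdE.
rewrite /sq_norm !sum2E -!/(gcomp _ _ x) !gradE (mcomp_sym 1 0 Dx) /sqgrad.
have := mdet_neq0 Dx; have [-> -> -> ->] := minvE Dx; rewrite /mdet.
by generalize_atoms => d0; field.
Qed.

Section OnOpen.
Variables (W : set S).
Hypotheses (oW : open W) (WD : W `<=` D).

Lemma laplacianD f g x : smooth_in i W f -> smooth_in i W g -> W x ->
  laplacian i (fun y => f y + g y) x = laplacian i f x + laplacian i g x.
Proof.
move=> Hf Hg Wx; have Hfg := smooth_inD gc oW WD Hf Hg.
rewrite !(laplacianE oW WD) // /hessian.
have E1 y l : W y -> pd i l (fun y => f y + g y) y = pd i l f y + pd i l g y.
  by move=> Wy; rewrite (has_pdE (has_pdD gc (smooth_in_has_pd Hf Wy) (smooth_in_has_pd Hg Wy))).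
have E2 k l : pd i k (pd i l (fun y => f y + g y)) x =
    pd i k (pd i l f) x + pd i k (pd i l g) x.
  rewrite (@pd_near _ _ _ gc k _ (fun y => pd i l f y + pd i l g y) x).
  - have Hd h : smooth_in i W h -> has_pd i (pd i l h) x (fun k => pd i k (pd i l h) x).
      by move=> Hh; exact: smooth_in_has_pd (smooth_in_pderiv l Hh) Wx.
    by rewrite (has_pdE (has_pdD gc (Hd _ Hf) (Hd _ Hg))).
  - exact: WD.
  - by apply: filterS (near_W oW Wx) => y Wy; exact: E1.
rewrite !E2 !E1 //; generalize_atoms; ring.
Qed.

Section Chain.
Variables (phi phi1 phi2 : R -> R) (f : S -> R).
Hypotheses (Hf : smooth_in i W f) (Hphi : smooth_in i W (fun y => phi (f y))).
Hypothesis d1 : forall y, W y -> is_derive (f y) (1:R) phi (phi1 (f y)).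
Hypothesis d2 : forall y, W y -> is_derive (f y) (1:R) phi1 (phi2 (f y)).

Lemma pd_chain l y : W y -> pd i l (fun z => phi (f z)) y = phi1 (f y) * pd i l f y.
Proof.
move=> Wy.
by rewrite (has_pdE (has_pd_comp gc (WD Wy) (d1 Wy) (smooth_in_has_pd Hf Wy))).
Qed.

Lemma laplacian_chain x : W x -> laplacian i (fun y => phi (f y)) x =
  phi1 (f x) * laplacian i f x + phi2 (f x) * sqgrad i f x.
Proof.
move=> Wx; rewrite !(laplacianE oW WD) // /hessian /sqgrad.
have E2 k l : pd i k (pd i l (fun y => phi (f y))) x =
    phi1 (f x) * pd i k (pd i l f) x + phi2 (f x) * pd i k f x * pd i l f x.
  rewrite (@pd_near _ _ _ gc k _ (fun y => phi1 (f y) * pd i l f y) x).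
  - rewrite (has_pdE (has_pdM gc (WD Wx)
      (has_pd_comp gc (WD Wx) (d2 Wx) (smooth_in_has_pd Hf Wx))
      (smooth_in_has_pd (smooth_in_pderiv l Hf) Wx))).
    by [].
  - exact: WD.
  - by apply: filterS (near_W oW Wx) => y Wy; exact: pd_chain.
have gs : ginv 1 0 x = ginv 0 1 x by have [_ -> -> _] := minvE (WD Wx).
rewrite !E2 !pd_chain // gs (pdC gc oW WD 1 0 Hf Wx).
rewrite ?(christoffel_sym _ 1 0 (WD Wx)).
generalize_atoms; move: (phi1 _) (phi2 _) => p1 p2; ring.
Qed.

Lemma sqgrad_chain x : W x ->
  sqgrad i (fun y => phi (f y)) x = phi1 (f x) ^+ 2 * sqgrad i f x.
Proof.
move=> Wx; rewrite /sqgrad !pd_chain //.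
generalize_atoms; move: (phi1 _) => p1; ring.
Qed.
End Chain.

Lemma laplacian_ln f x : smooth_in i W f -> (forall y, W y -> 0 < f y) -> W x ->
  laplacian i (fun y => ln (f y)) x =
  (f x)^-1 * laplacian i f x - (f x) ^- 2 * sqgrad i f x.
Proof.
move=> Hf f0 Wx.
have d1 y : W y -> is_derive (f y) (1:R) (@ln R) (f y)^-1.
  by move=> Wy; apply: is_derive1_ln; exact: f0.
have d2 y : W y -> is_derive (f y) (1:R) (fun t : R => t^-1) (- (f y) ^- 2).
  by move=> Wy; apply: is_derive_inv; rewrite gt_eqF // f0.
have sln := smooth_in_ln gc oW WD f0 Hf.
by rewrite (laplacian_chain (phi1 := fun t => t^-1) (phi2 := fun t => - t ^- 2)
  Hf sln d1 d2 Wx) mulNr.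
Qed.

End OnOpen.

End Metric.

(** * Curvature and conformal change *)

Lemma riemannE (R : realType) (S : surface R) (i : chart S) p x :
  riemann i p 0 1 1 x =
  pd i 0 (christoffel i p 1 1) x - pd i 1 (christoffel i p 0 1) x +
  (christoffel i 0 1 1 x * christoffel i p 0 0 x
   - christoffel i 0 0 1 x * christoffel i p 1 0 x +
  (christoffel i 1 1 1 x * christoffel i p 0 1 x
   - christoffel i 1 0 1 x * christoffel i p 1 1 x)).
Proof. by rewrite /riemann sum2E pdE. Qed.

Lemma chart_curvatureE (R : realType) (S : surface R) (i : chart S) x :
  chart_curvature i x = (riemann i 0 0 1 1 x * mcomp i 0 0 x +
    riemann i 1 0 1 1 x * mcomp i 1 0 x) / \det (metric i x).
Proof. by rewrite /chart_curvature sum2E. Qed.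

(** The metric w ds^2 on the whole of S.  It is degenerate where w vanishes, and
    is only used on open sets where w is positive. *)
Definition conformal (R : realType) (S : surface R) (w : S -> R) : surface R :=
  @Surface R S (chart S) (fun i => dom i) (fun i => Defs.coord i)
    (fun i (x : S) => w x *: metric i x).

Section Conformal.
Variables (R : realType) (S : surface R) (i : chart S) (w : S -> R).
Hypothesis gm : good_metric i.
Variable W : set S.
Hypotheses (oW : open W) (WD : W `<=` dom i).
Hypotheses (sw : smooth_in i W w) (w0 : forall x, W x -> 0 < w x).
Let S' := conformal w.
Let i' : chart S' := i.
Let gc : good_chart i := gm.
Implicit Types (f : S -> R) (x y : S) (k l m n : 'I_2).

Lemma pd_conf k f x : @pd R S' i' k f x = pd i k f x.
Proof. by rewrite pdE. Qed.

Lemma minv_conf k l x : W x -> @minv R S' i' k l x = (w x)^-1 * minv i k l x.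
Proof.
move=> Wx; rewrite /minv /inv_metric -[metric i' x]/(w x *: metric i x) invmxZ ?mxE //.
have Dx := WD Wx; rewrite unitmxE unitfE detZ (mdetE gm Dx).
by rewrite mulf_neq0 ?expf_neq0 ?(mdet_neq0 gm Dx) // gt_eqF // w0.
Qed.

Lemma mcomp_conf k l x : @mcomp R S' i' k l x = w x * mcomp i k l x.
Proof. by rewrite /mcomp mxE. Qed.

Lemma vol_conf x : W x -> @vol R S' i' x = w x * vol i x.
Proof.
move=> Wx; rewrite /vol -[metric i' x]/(w x *: metric i x) detZ sqrtrM ?sqr_ge0 // sqrtr_sqr.
by rewrite gtr0_norm ?w0.
Qed.

(** On a surface the volume density is multiplied by w and the inverse metric by
    w^-1, so the vector field under the divergence does not change. *)
Lemma laplacian_conf f x : W x ->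
  @laplacian R S' i' f x = (w x)^-1 * laplacian i f x.
Proof.
move=> Wx; rewrite /laplacian /divergence.
have E k : pd i k (fun y => @vol R S' i' y * @grad R S' i' f y k) x =
   pd i k (fun y => vol i y * grad i f y k) x.
  apply: (pd_near gc _ (WD Wx)); apply: filterS (near_W oW Wx) => y Wy.
  rewrite vol_conf // /grad !sum2E.
  have := minv_conf k 0 Wy; have := minv_conf k 1 Wy; rewrite /minv => -> ->.
  rewrite -!pdE !pd_conf; have := w0 Wy.
  move: (inv_metric i y k 0) (inv_metric i y k 1) (vol i y) (w y).
  by generalize_atoms => a1 b1 c1 d1 /gt_eqF /negbT d0; field.
rewrite -pdE vol_conf // invfM -mulrA; congr (_ * (_ * _)).
by apply: eq_bigr => k _; rewrite pd_conf; exact: E.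
Qed.

Lemma sqgrad_conf f x : W x -> @sqgrad R S' i' f x = (w x)^-1 * sqgrad i f x.
Proof.
move=> Wx; rewrite /sqgrad !minv_conf // !pd_conf; generalize_atoms.
by move: (_^-1) => z; ring.
Qed.

Local Notation lw := (fun y => ln (w y)).
Local Notation p k := (pd i k lw).

Lemma pd_w k x : W x -> pd i k w x = w x * p k x.
Proof.
move=> Wx; have wx0 : w x != 0 by rewrite gt_eqF // w0.
rewrite (has_pdE (has_pd_comp gc (WD Wx) (is_derive1_ln (w0 Wx)) (smooth_in_has_pd sw Wx))).
by rewrite mulrA divff // mul1r.
Qed.

Lemma dmetric_conf n k l x : W x -> @dmetric R S' i' n k l x =
  w x * (dmetric i n k l x + p n x * mcomp i k l x).
Proof.
move=> Wx; rewrite /dmetric pd_conf.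
have -> : @mcomp R S' i' k l = (fun y => w y * mcomp i k l y).
  by apply/funext => y; rewrite mcomp_conf.
rewrite (has_pdE (has_pdM gc (WD Wx) (smooth_in_has_pd sw Wx)
  (smooth_in_has_pd (smooth_mcomp gm k l) (WD Wx)))) pd_w //.
by generalize_atoms; move: (w x) => z; ring.
Qed.

Lemma minv_mcomp k m x : dom i x ->
  minv i k 0 x * mcomp i m 0 x + minv i k 1 x * mcomp i m 1 x = (k == m)%:R.
Proof.
move=> Dx; have := mdet_neq0 gm Dx; have [i1 i2 i3 i4] := minvE gm Dx.
case: (I2P k) => ->; case: (I2P m) => ->; rewrite ?i1 ?i2 ?i3 ?i4 /mdet
 ?(mcomp_sym gm 1 0 Dx) /=; generalize_atoms => d0; by field.
Qed.

(** The difference of the two connections is a tensor, built from the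
    differential of ln w. *)
Lemma christoffel_conf k l m x : W x -> @christoffel R S' i' k l m x =
  christoffel i k l m x + 2^-1 * ((k == l)%:R * p m x + (k == m)%:R * p l x
   - mcomp i l m x * (minv i k 0 x * p 0 x + minv i k 1 x * p 1 x)).
Proof.
move=> Wx; have Dx := WD Wx; rewrite !christoffelE !minv_conf // !dmetric_conf //.
rewrite -(minv_mcomp k l Dx) -(minv_mcomp k m Dx).
have := w0 Wx; move: (w x) => z.
by generalize_atoms => /gt_eqF /negbT z0; field.
Qed.

Lemma pd_christoffel_conf n k l m x : W x ->
  pd i n (@christoffel R S' i' k l m) x = pd i n (christoffel i k l m) x +
  2^-1 * ((k == l)%:R * pd i n (pd i m lw) x + (k == m)%:R * pd i n (pd i l lw) x
   - (dmetric i n l m x * (minv i k 0 x * p 0 x + minv i k 1 x * p 1 x) +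
      mcomp i l m x *
        (pd i n (minv i k 0) x * p 0 x + minv i k 0 x * pd i n (pd i 0 lw) x +
         (pd i n (minv i k 1) x * p 1 x + minv i k 1 x * pd i n (pd i 1 lw) x)))).
Proof.
move=> Wx; have Dx := WD Wx.
have sl := smooth_in_ln gc oW WD w0 sw.
have sc := smooth_in_has_pd (smooth_christoffel gm k l m) Dx.
have sp a := smooth_in_has_pd (smooth_in_pderiv a sl) Wx.
have si a := smooth_in_has_pd (smooth_minv gm k a) Dx.
have sg := smooth_in_has_pd (smooth_mcomp gm l m) Dx.
have cst r := has_pd_cst gc r Dx.
have h1 := has_pdM gc Dx sg (has_pdD gc (has_pdM gc Dx (si 0) (sp 0)) (has_pdM gc Dx (si 1) (sp 1))).
have h2 := has_pdD gc (has_pdD gc (has_pdM gc Dx (cst (k == l)%:R) (sp m))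
   (has_pdM gc Dx (cst (k == m)%:R) (sp l))) (has_pdM gc Dx (cst (-1)) h1).
have h3 := has_pdD gc sc (has_pdM gc Dx (cst 2^-1) h2).
rewrite (has_pdE (@has_pd_near _ _ _ gc _ (@christoffel R S' i' k l m) _ _ Dx _ h3)).
  by rewrite /dmetric; generalize_atoms; move: (_%:R) (_%:R) => d1 d2; ring.
apply: filterS (near_W oW Wx) => y Wy; rewrite christoffel_conf //.
by rewrite mulN1r.
Qed.

(** Substituting [christoffel_conf] into the curvature leaves a rational identity
    in the metric, its Christoffel symbols and the derivatives of ln w; the
    derivatives of the Christoffel symbols only enter through the curvature of
    the initial metric.  The two mixed derivatives of ln w agree by
    [pdC]. *)
Lemma chart_curvature_conf x : W x ->
  @chart_curvature R S' i' x =
  (w x)^-1 * (chart_curvature i x - 2^-1 * laplacian i lw x).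
Proof.
move=> Wx; have Dx := WD Wx.
have sl := smooth_in_ln gc oW WD w0 sw.
rewrite !chart_curvatureE !riemannE !pd_conf !pd_christoffel_conf // !christoffel_conf //.
rewrite (laplacianE gm oW WD sl Wx) /hessian.
rewrite -[metric i' x]/(w x *: metric i x) detZ (mdetE gm Dx) !mcomp_conf.
rewrite (pdC gc oW WD 1 0 sl Wx).
rewrite !(pd_minv gm _ _ _ Dx) !(dmetricE gm _ _ _ Dx).
have [i1 i2 i3 i4] := minvE gm Dx; have := mdet_neq0 gm Dx.
rewrite i1 i2 i3 i4 !(mcomp_sym gm 1 0 Dx) /mdet.
rewrite !(christoffel_sym gm _ 1 0 Dx) /=.
have := w0 Wx; move: (w x) => z.
generalize_atoms => /gt_eqF /negbT z0 d0.
by field; rewrite d0 z0.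
Qed.

End Conformal.

(** * Maximum principle and barriers *)

Section MoreMetric.
Variables (R : realType) (S : surface R) (i : chart S).
Hypothesis gm : good_metric i.
Local Notation D := (dom i).
Let gc : good_chart i := gm.
Implicit Types (f : S -> R) (x y : S).

Section OnOpen.
Variables (W : set S).
Hypotheses (oW : open W) (WD : W `<=` D).

(** Complete the square: g00 det g times the inverse metric evaluated on (x, y)
    is (g00 y - g01 x)^2 + x^2 det g. *)
Lemma sqgrad_gt0 f x : D x -> (pd i 0 f x != 0) || (pd i 1 f x != 0) ->
  0 < sqgrad i f x.
Proof.
move=> Dx; rewrite /sqgrad; have E0 := mcomp00_gt0 gm Dx; have d0 := mdet_gt0 gm Dx.
have [-> -> _ ->] := minvE gm Dx.
move: E0 d0; rewrite /mdet; generalize_atoms => E0 d0 nz.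
have d1 : a * a0 - a1 * a1 != 0 by rewrite gt_eqF.
have a0' : a != 0 by rewrite gt_eqF.
have -> : a0 / (a * a0 - a1 * a1) * a2 ^+ 2 + 2 * (- a1 / (a * a0 - a1 * a1)) * a2 * a3 +
  a / (a * a0 - a1 * a1) * a3 ^+ 2 =
  ((a * a3 - a1 * a2) ^+ 2 + (a * a0 - a1 * a1) * a2 ^+ 2) / (a * (a * a0 - a1 * a1)).
  by field; rewrite d1 a0'.
apply: divr_gt0; last exact: mulr_gt0.
have [z2|nz2] := eqVneq a2 0.
  move: nz; rewrite z2 eqxx /= => nz3.
  by rewrite mulr0 subr0 expr0n mulr0 addr0 exprn_even_gt0 // mulf_neq0.
by rewrite ltr_wpDl ?sqr_ge0 // mulr_gt0 // exprn_even_gt0.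
Qed.

Lemma smooth_sqgrad f : smooth_in i W f -> smooth_in i W (sqgrad i f).
Proof.
move=> Hf.
have M := smooth_inM gc oW WD; have A := smooth_inD gc oW WD.
have si k l := smooth_in_sub WD (smooth_minv gm k l).
have sd k := smooth_in_pderiv k Hf.
apply: (smooth_in_eq gc oW WD) (A _ _ (A _ _ (M _ _ (si 0 0) (M _ _ (sd 0) (sd 0)))
  (M _ _ (M _ _ (M _ _ (smooth_in_cst gc oW WD 2) (si 0 1)) (sd 0)) (sd 1)))
  (M _ _ (si 1 1) (M _ _ (sd 1) (sd 1)))).
by move=> x _; rewrite /sqgrad !expr2.
Qed.

Lemma smooth_laplacian f : smooth_in i W f -> smooth_in i W (laplacian i f).
Proof.
move=> Hf.
have M := smooth_inM gc oW WD; have A := smooth_inD gc oW WD.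
have B := smooth_inB gc oW WD.
have si k l := smooth_in_sub WD (smooth_minv gm k l).
have sc k l m := smooth_in_sub WD (smooth_christoffel gm k l m).
have sd k := smooth_in_pderiv k Hf.
have sh k l : smooth_in i W (hessian i f k l).
  exact: (B _ _ (smooth_in_pderiv k (sd l)) (A _ _ (M _ _ (sc 0 k l) (sd 0)) (M _ _ (sc 1 k l) (sd 1)))).
have st k l := M _ _ (si k l) (sh k l).
apply: (smooth_in_eq gc oW WD) (A _ _ (A _ _ (st 0 0) (st 0 1)) (A _ _ (st 1 0) (st 1 1))).
by move=> x Wx; rewrite (laplacianE gm oW WD Hf Wx).
Qed.

(** At a maximum the differential vanishes and the matrix of second derivatives
    is negative semidefinite, and so is its trace against the inverse metric. *)
Lemma laplacian_local_max f x : smooth_in i W f -> W x ->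
  (\forall y \near x, f y <= f x) -> laplacian i f x <= 0.
Proof.
move=> Hf Wx mx; have Dx := WD Wx.
(* Up to the factor g00 det g, the inverse metric is the sum of the square of
   the direction (- g01, g00) and of det g times the square of (1, 0); the
   direction (0, 1) serves to kill the differential. *)
have [] := local_max_pd gc oW WD (fun k => if k == 0 then 1 else 0) Hf Wx mx.
have [] := local_max_pd gc oW WD (fun k => if k == 0 then 0 else 1) Hf Wx mx.
have [] := local_max_pd gc oW WD (fun k => if k == 0 then - mcomp i 0 1 x else mcomp i 0 0 x) Hf Wx mx.
rewrite (laplacianE gm oW WD Hf Wx) /hessian /= => _ Q p1 _ p0 Q0.
have E0 := mcomp00_gt0 gm Dx; have d0 := mdet_gt0 gm Dx.
have [-> -> -> ->] := minvE gm Dx.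
move: E0 d0 p0 p1 Q Q0; rewrite /mdet; generalize_atoms => E0 d0 h1 h2.
have {h1}-> : a10 = 0 by lra.
have {h2}-> : a11 = 0 by lra.
set Q := (X in X <= 0 -> _) => Q1 Q2.
have {Q2} : a12 <= 0 by lra.
have d1 : a7 * a8 - a9 * a9 != 0 by rewrite gt_eqF.
have E1 : a7 != 0 by rewrite gt_eqF.
move=> Q2; set L := (X in X <= 0).
have -> : L = (Q + (a7 * a8 - a9 * a9) * a12) / (a7 * (a7 * a8 - a9 * a9)).
  by rewrite /L /Q; field; rewrite d1 E1.
rewrite pmulr_lle0 ?invr_gt0; last exact: mulr_gt0.
have Q3 := mulr_ge0_le0 (ltW d0) Q2; lra.
Qed.
End OnOpen.
End MoreMetric.

Lemma chart_EVT (R : realType) (S : surface R) (i : chart S) (g : S -> R)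
    (A : set 'rV[R]_2) :
  good_chart i -> A !=set0 -> compact A -> A `<=` Defs.coord i @` dom i ->
  (forall x, dom i x -> {for x, continuous g}) ->
  exists x, [/\ dom i x, A (Defs.coord i x) &
    forall y, dom i y -> A (Defs.coord i y) -> g y <= g x].
Proof.
move=> gc A0 cA AD cg.
have [|v] := @compact_EVT_max _ R (in_chart i g) A A0 cA.
  apply: continuous_in_subspaceT => v; rewrite inE => /AD [x Dx <-].
  exact: in_chart_continuous (cg x Dx).
rewrite inE => Av mx; have [x Dx Ex] := AD _ Av; exists x; split => //.
  by rewrite Ex.
move=> y Dy Ay; rewrite -(in_chartE gc g Dy) -(in_chartE gc g Dx) Ex.
by apply: mx; rewrite inE.
Qed.

(** The Euclidean squared distance: the norm of the space of rows is the maximum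
    norm, whose square is not differentiable. *)
Definition sqdist (R : realType) (q v : 'rV[R]_2) : R :=
  (v 0 0 - q 0 0) ^+ 2 + (v 0 1 - q 0 1) ^+ 2.

Lemma sqdist_continuous (R : realType) (q : 'rV[R]_2) : continuous (sqdist q).
Proof.
move=> v; have C k : {for v, continuous (fun w : 'rV[R]_2 => (w 0 k - q 0 k) ^+ 2)}.
  apply: (@continuous_comp _ _ _ (fun w : 'rV[R]_2 => w 0 k - q 0 k) (fun t : R => t ^+ 2)).
    by apply: continuousB; [exact: coord_continuous | exact: cst_continuous].
  exact: exprn_continuous.
exact: (continuousD (C 0) (C 1)).
Qed.

Lemma annulus_compact (R : realType) (q : 'rV[R]_2) (r1 r2 : R) :
  compact [set v : 'rV[R]_2 | r1 <= sqdist q v <= r2].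
Proof.
pose B k := `[q 0 k - (`|r2| + 1), q 0 k + (`|r2| + 1)]%classic : set R.
apply: (@subclosed_compact _ _ [set v : 'rV[R]_2 | forall k, B k (v ord0 k)]).
- have -> : [set v : 'rV[R]_2 | r1 <= sqdist q v <= r2] =
     sqdist q @^-1` `[r1, r2]%classic.
    by apply/funext => v; rewrite /= in_itv.
  apply: preimage_closed; last exact: interval_closed.
  by move=> v _; exact: sqdist_continuous.
- by apply: rV_compact => k; exact: segment_compact.
move=> v /= /andP [_ hv] k; rewrite /B /= in_itv /=.
have h2 : (v 0 k - q 0 k) ^+ 2 <= r2.
  apply: le_trans hv; rewrite /sqdist; case: (I2P k) => ->.
    by rewrite lerDl sqr_ge0.
  by rewrite lerDr sqr_ge0.
have : `|v 0 k - q 0 k| <= `|r2| + 1.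
  rewrite leNgt; apply/negP => lt.
  have := ler_norm r2; have := normr_ge0 r2 => n0 n1.
  have : (`|r2| + 1) ^+ 2 < `|v 0 k - q 0 k| ^+ 2 by rewrite ltrXn2r // nnegrE; lra.
  by rewrite real_normK ?num_real //; nra.
by rewrite ler_norml => ?; lra.
Qed.

Lemma ln_shift (R : realType) (a b s t : R) : 0 < a -> 0 < b ->
  a * expR s <= b * expR t -> ln a + s <= ln b + t.
Proof.
move=> a0 b0; rewrite -ler_ln ?posrE ?mulr_gt0 ?expR_gt0 //.
by rewrite !lnM ?posrE ?expR_gt0 // !expRK.
Qed.

Section Barrier.
Variables (R : realType) (S : surface R) (i : chart S).
Hypothesis gm : good_metric i.
Local Notation D := (dom i).
Local Notation c := (Defs.coord i).
Hypothesis coord_smooth : forall k, smooth_in i D (fun x => c x 0 k).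
Let gc : good_chart i := gm.
Let oD : open D := gc_open gc.
Let DD : D `<=` D := @subset_refl _ D.
Variable q : 'rV[R]_2.
Local Notation rho := (fun x : S => sqdist q (c x)).

Lemma pd_coord k l x : D x -> pd i k (fun y => c y 0 l) x = (k == l)%:R.
Proof.
move=> Dx; suff H : has_pd i (fun y => c y 0 l) x (fun k => (k == l)%:R).
  by rewrite (has_pdE H).
move=> {}k.
apply: (@near_eq_is_derive _ _ _ (fun v : 'rV[R]_2 => v 0 l)).
  by apply: filterS (near_chart gc Dx (near_dom gc Dx)) => v [y [Dy <- _]]; rewrite in_chartE.
have : is_derive (0:R) (1:R) (fun t : R => (c x + t *: axis k) 0 l) (k == l)%:R.
  have -> : (fun t : R => (c x + t *: (axis k : 'rV[R]_2)) 0 l) = (fun t : R => c x 0 l + (k == l)%:R * t).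
    by apply/funext => t; rewrite !mxE eqxx /= mulrC eq_sym.
  have := is_deriveD (is_derive_cst (c x 0 l) (0:R) (1:R))
    (@is_deriveZ _ _ _ id (k == l)%:R (0:R) (1:R) 1 (is_derive_id _ _)).
  by rewrite add0r [_ *: 1]mulr1.
move=> /(is_derive_lineE (fun v : 'rV[R]_2 => v 0 l)).
by rewrite scale0r addr0.
Qed.

Lemma smooth_rho : smooth_in i D rho.
Proof.
have M := smooth_inM gc oD DD; have A := smooth_inD gc oD DD.
have B k : smooth_in i D (fun x => c x 0 k - q 0 k).
  exact: (smooth_inB gc oD DD (coord_smooth k) (smooth_in_cst gc oD DD _)).
apply: (smooth_in_eq gc oD DD) (A _ _ (M _ _ (B 0) (B 0)) (M _ _ (B 1) (B 1))).
by move=> x _; rewrite /sqdist !expr2.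
Qed.

Lemma pd_rho k x : D x -> pd i k rho x = 2 * (c x 0 k - q 0 k).
Proof.
move=> Dx.
have B l : has_pd i (fun x => (c x 0 l - q 0 l)) x (fun k => (k == l)%:R).
  have := has_pdD gc (smooth_in_has_pd (coord_smooth l) Dx) (has_pd_cst gc (- q 0 l) Dx).
  by move=> /has_pd_eq; apply => m; rewrite addr0 pd_coord.
have -> : rho = (fun x => (c x 0 0 - q 0 0) * (c x 0 0 - q 0 0) +
   (c x 0 1 - q 0 1) * (c x 0 1 - q 0 1)).
  by apply/funext => y; rewrite /sqdist !expr2.
rewrite (has_pdE (has_pdD gc (has_pdM gc Dx (B 0) (B 0)) (has_pdM gc Dx (B 1) (B 1)))).
by case: (I2P k) => -> /=; rewrite !(mulr1, mul1r, mulr0, mul0r, addr0, add0r) mulr_natl mulr2n.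
Qed.

Lemma sqgrad_rho_gt0 x : D x -> 0 < rho x -> 0 < sqgrad i rho x.
Proof.
move=> Dx r0; apply: (sqgrad_gt0 gm) => //; rewrite !pd_rho //.
rewrite -negb_and !mulf_eq0 pnatr_eq0 /=; apply: contraTN r0 => /andP [/eqP a /eqP b].
by rewrite /sqdist a b !expr0n addr0 ltxx.
Qed.

(** The factor al^2 in front of a positive squared gradient beats the factor al
    in front of the Laplacian of rho, so for al large this is positive away
    from q. *)
Lemma laplacian_barrier (al N : R) x : D x ->
  laplacian i (fun y => N * expR (- al * rho y)) x =
  N * expR (- al * rho x) * (al ^+ 2 * sqgrad i rho x - al * laplacian i rho x).
Proof.
move=> Dx.
have dE (t : R) : is_derive t (1:R) (fun t : R => expR (- al * t)) (expR (- al * t) * - al).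
  have h : is_derive t (1:R) (fun t : R => - al * t) (- al).
    have := @is_deriveZ _ _ _ id (- al) t (1:R) 1 (is_derive_id _ _).
    by rewrite [_ *: 1]mulr1.
  exact: (@is_derive1_comp _ expR (fun t : R => - al * t) t _ _ (is_derive_expR _) h).
have d (M t : R) : is_derive t (1:R) (fun t : R => M * expR (- al * t)) (M * - al * expR (- al * t)).
  have := is_deriveZ M (dE t); rewrite -[M *: (_ * _)]/(M * (_ * _)) mulrA mulrAC.
  by [].
have sp : smooth_in i D (fun y => N * expR (- al * rho y)).
  apply: (smooth_inM gc oD DD (smooth_in_cst gc oD DD N)).
  apply: (smooth_in_exp gc oD DD).
  exact: (smooth_inM gc oD DD (smooth_in_cst gc oD DD _) smooth_rho).
rewrite (laplacian_chain gm oD DD (phi := fun t => N * expR (- al * t))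
  (phi1 := fun t => N * - al * expR (- al * t))
  (phi2 := fun t => N * - al * - al * expR (- al * t)) smooth_rho sp (fun y _ => d _ _) (fun y _ => d _ _) Dx).
move: (laplacian _ _ _) (sqgrad _ _ _) (expR _) => a b z; ring.
Qed.

Section Propagation.
Variables (f kappa : S -> R) (r1 r2 : R).
Local Notation P := [set x | D x /\ 0 < f x].
Hypothesis r1_gt0 : 0 < r1.
Hypothesis disc_in_chart : [set v | sqdist q v <= r2] `<=` c @` D.
Hypothesis cf : forall x, D x -> {for x, continuous f}.
Hypothesis f_ge0 : forall x, D x -> 0 <= f x.
Hypothesis sf : smooth_in i P f.
Hypothesis ckappa : forall x, D x -> {for x, continuous kappa}.
Hypothesis lap_ln_f : forall x, D x -> 0 < f x ->
  kappa x <= laplacian i (fun y => ln (f y)) x.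
Hypothesis f0_inner : forall x, D x -> rho x <= r1 -> f x = 0.

Let open_P : open P.
Proof.
rewrite openE => x [Dx fx]; apply: filterI; first exact: near_dom.
have := cf Dx; move=> /(_ [set t | 0 < t]); apply.
by apply: open_nbhs_nbhs; split; [exact: open_gt|].
Qed.

(** Hopf's barrier argument.  Let h = exp (- al rho), with value h2 on the
    outer circle of the annulus r1 <= rho <= r2.  If f x > 0, then for N large
    f exp (N (h - h2)) is larger at x than on the boundary of the annulus.
    At an interior maximum its logarithm has a nonpositive Laplacian, which
    contradicts kappa + N mu > 0, where mu bounds the Laplacian of h from below. *)
Lemma zero_propagation x : D x -> rho x < r2 -> f x = 0.
Proof.
move=> Dx0 rx; apply/eqP; apply: contraT => fx0.
have {}fx0 : 0 < f x by rewrite lt_neqAle eq_sym fx0 f_ge0.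
have r1x : r1 < rho x.
  by rewrite ltNge; apply/negP => /(f0_inner Dx0) E; rewrite E ltxx in fx0.
set A := [set v | r1 <= sqdist q v <= r2].
have A0 : A !=set0 by exists (c x); rewrite /A /= !ltW.
have cA : compact A by exact: annulus_compact.
have AD : A `<=` c @` D by move=> v /andP [_ h]; exact: disc_in_chart.
have cs g : smooth_in i D g -> forall y, D y -> {for y, continuous g}.
  by move=> Hg y Dy; exact: smooth_in_continuous Hg Dy.
have EVT (g : S -> R) : (forall y, D y -> {for y, continuous g}) -> exists y, [/\ D y, A (c y) &
    forall z, D z -> A (c z) -> g z <= g y] .
  by move=> cg; exact: (chart_EVT gc A0 cA AD cg).
have [m m0 Hm] : exists2 m, 0 < m & forall z, D z -> A (c z) -> m <= sqgrad i rho z.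
  have [] := EVT (fun y => - sqgrad i rho y).
    by apply: cs; apply: (smooth_inN gc oD DD); exact: (smooth_sqgrad gm oD DD smooth_rho).
  move=> y [Dy /= /andP [Ay _] H]; exists (sqgrad i rho y).
    by apply: sqgrad_rho_gt0 => //; exact: lt_le_trans Ay.
  by move=> z Dz Az; rewrite -lerN2; exact: H.
have [M HM] : exists M, forall z, D z -> A (c z) -> laplacian i rho z <= M.
  have [] := EVT (laplacian i rho).
    by apply: cs; exact: (smooth_laplacian gm oD DD smooth_rho).
  by move=> y [_ _ H]; exists (laplacian i rho y).
have [k Hk] : exists k, forall z, D z -> A (c z) -> - k <= kappa z.
  have [] := EVT (fun y => - kappa y).
    by move=> y Dy; apply: continuousN; exact: ckappa.
  by move=> y [_ _ H]; exists (- kappa y) => z Dz Az; rewrite lerNl; exact: H.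
have [B HB] : exists B, forall z, D z -> A (c z) -> f z <= B.
  by have [y [_ _ H]] := EVT f cf; exists (f y).
(* Chosen so that al m - M >= 1, hence al (al m - M) >= al. *)
set al := (`|M| + 1) / m.
have al0 : 0 < al by rewrite divr_gt0 // ltr_wpDl.
set h := fun y => expR (- al * rho y); set h2 := expR (- al * r2).
set mu := h2 * al.
have mu0 : 0 < mu by rewrite mulr_gt0 // expR_gt0.
have hx : 0 < h x - h2.
  by rewrite subr_gt0 ltr_expR ltr_nM2l ?oppr_lt0.
have lap_h N y : 0 <= N -> D y -> A (c y) ->
    N * mu <= laplacian i (fun y => N * h y) y.
  move=> N0 Dy Ay; rewrite laplacian_barrier // -mulrA ler_wpM2l // /mu.
  apply: ler_pM; rewrite ?expR_ge0 ?(ltW al0) //.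
    have /andP [_ Ay2] := Ay; by rewrite ler_expR ler_nM2l ?oppr_lt0.
  have -> : al ^+ 2 * sqgrad i rho y - al * laplacian i rho y =
    al * (al * sqgrad i rho y - laplacian i rho y) by move: (sqgrad _ _ _) (laplacian _ _ _) => ? ?; ring.
  rewrite ler_peMr ?(ltW al0) //.
  have e1 : `|M| + 1 <= al * sqgrad i rho y.
    by rewrite /al mulrAC ler_pdivlMr // ler_wpM2l ?Hm // addr_ge0.
  have e2 := HM _ Dy Ay; have e3 := ler_norm M.
  by move: e1 e2 e3; move: (sqgrad _ _ _) (laplacian _ _ _) `|M| => u v w e1 e2 e3; lra.
(* The first term makes N mu exceed k, which bounds - kappa from above; the
   second one makes f x (1 + N (h x - h2)) exceed the bound B of f. *)
set N := (`|k| + 1) / mu + `|B| / (f x * (h x - h2)).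
have fh0 : 0 < f x * (h x - h2) by exact: mulr_gt0.
have N0 : 0 <= N by rewrite addr_ge0 // divr_ge0 ?addr_ge0 // ltW.
have Nmu : k < N * mu.
  have : `|k| + 1 <= N * mu.
    by rewrite -ler_pdivrMr // /N lerDl divr_ge0 // ltW.
  have := ler_norm k; lra.
have Nx : B < f x * expR (N * (h x - h2)).
  have e1 : `|B| <= N * (f x * (h x - h2)).
    by rewrite -ler_pdivrMr // /N lerDr divr_ge0 // ?addr_ge0 // ltW.
  have e2 := expR_ge1Dx (N * (h x - h2)); have e3 := ler_norm B.
  have : f x * (1 + N * (h x - h2)) <= f x * expR (N * (h x - h2)) by rewrite ler_pM2l.
  move=> e4; apply: lt_le_trans e4.
  have -> : f x * (1 + N * (h x - h2)) = f x + N * (f x * (h x - h2)) by ring.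
  by lra.
have sh : smooth_in i D h.
  apply: (smooth_in_exp gc oD DD).
  exact: (smooth_inM gc oD DD (smooth_in_cst gc oD DD _) smooth_rho).
(* The maximum is not on the inner circle, where f vanishes, nor on the outer
   one, where the exponential factor is 1. *)
have [y [Dy Ay Hy]] := EVT (fun y => f y * expR (N * (h y - h2))) ltac:(
  move=> z Dz; apply: continuousM; [exact: cf|];
  apply: (@continuous_comp _ _ _ (fun y => N * (h y - h2)) expR); [|exact: continuous_expR];
  apply: continuousM; [exact: cst_continuous|];
  apply: continuousB; [exact: cs sh z Dz|exact: cst_continuous]).
have yB : B < f y * expR (N * (h y - h2)).
  by apply: lt_le_trans Nx _; apply: Hy => //; rewrite /A /= !ltW.
have B0 : 0 < B by apply: lt_le_trans fx0 _; apply: HB => //; rewrite /A /= !ltW.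
have fy0 : 0 < f y.
  rewrite lt_neqAle f_ge0 // andbT eq_sym; apply/negP => /eqP E.
  by move: yB; rewrite E mul0r; move: B0; lra.
have /andP [Ay1 Ay2] := Ay.
have ry1 : r1 < rho y.
  rewrite lt_neqAle Ay1 andbT; apply/negP => /eqP E.
  by move: fy0; rewrite f0_inner ?ltxx // E.
have ry2 : rho y < r2.
  rewrite lt_neqAle Ay2 andbT; apply/negP => /eqP E.
  move: yB; rewrite /h E subrr mulr0 expR0 mulr1 => yB.
  by have := HB _ Dy Ay; rewrite leNgt yB.
have nearP : \forall z \near y, P z by apply: open_nbhs_nbhs.
have nearA : \forall z \near y, A (c z).
  have C := cs _ smooth_rho y Dy.
  have : \forall z \near y, rho z \in `]r1, r2[.
    move: C => /(_ `]r1, r2[%classic); apply.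
    apply: open_nbhs_nbhs; split; first exact: interval_open.
    by rewrite /= in_itv /= ry1.
  by apply: filterS => z; rewrite in_itv /= => /andP [? ?]; rewrite /A /= !ltW.
have PD : P `<=` D by move=> z [].
have sln : smooth_in i P (fun z => ln (f z)).
  by apply: (smooth_in_ln gc open_P PD) => // z [].
have sNh : smooth_in i P (fun z => N * h z).
  exact: (smooth_in_sub PD (smooth_inM gc oD DD (smooth_in_cst gc oD DD N) sh)).
have Py : P y by [].
have lmax : \forall z \near y, ln (f z) + N * h z <= ln (f y) + N * h y.
  apply: filterS2 nearP nearA => z [Dz fz0] Az.
  have := ln_shift fz0 fy0 (Hy _ Dz Az).
  by rewrite !mulrBr !addrA lerD2r.
have := laplacian_local_max gm open_P PD (smooth_inD gc open_P PD sln sNh) Py lmax.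
rewrite (laplacianD gm open_P PD sln sNh Py) leNgt => /negP; case.
have e1 := lap_ln_f Dy fy0; have e2 := lap_h N y N0 Dy Ay; have e3 := Hk _ Dy Ay.
move: e1 e2 e3 Nmu; move: (laplacian _ _ _) (laplacian _ _ _) (kappa y) (N * mu) => u v w z.
lra.
Qed.
End Propagation.
End Barrier.

(** * Unique continuation on a surface *)

Section PlaneBalls.
Variable R : realType.
Implicit Types (q v : 'rV[R]_2) (r : R).

Lemma ball_sqdist q v r : 0 < r -> sqdist q v < r ^+ 2 -> ball q r v.
Proof.
move=> r0 H; split => // a k; rewrite ord1 -ball_normE /ball_ /= distrC.
have : (v 0 k - q 0 k) ^+ 2 < r ^+ 2.
  apply: le_lt_trans H; rewrite /sqdist; case: (I2P k) => ->.
    by rewrite lerDl sqr_ge0.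
  by rewrite lerDr sqr_ge0.
by rewrite -[X in X < _]real_normK ?num_real // ltr_pXn2r // nnegrE ltW.
Qed.

Lemma sqdist_ball q v r : ball q r v -> sqdist q v < 2 * r ^+ 2.
Proof.
move=> [r0 H]; rewrite /sqdist mulr_natl mulr2n.
have h k : (v 0 k - q 0 k) ^+ 2 < r ^+ 2.
  have := H 0 k; rewrite -ball_normE /ball_ /= distrC => h.
  by rewrite -[X in X < _]real_normK ?num_real // ltrXn2r // ?nnegrE ?normr_ge0 ?ltW.
exact: ltrD.
Qed.
End PlaneBalls.

Section Global.
Variables (R : realType) (S : surface R).
Hypothesis rs : riemannian_surface S.
Implicit Types (f : S -> R) (x : S) (i : chart S).

Lemma surface_good_metric i : good_metric i.
Proof.
split.
- split.
  + exact: dom_open rs i.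
  + by move=> x y; exact: (coord_inj rs).
  + by move=> x; exact: (Defs.coord_continuous rs).
  + by move=> V; exact: (coord_open rs).
- by move=> k l; exact: (metric_smooth rs).
- by move=> x; exact: (Defs.metric_sym rs).
- by move=> x v; exact: (metric_posdef rs).
Qed.

Lemma surface_coord_smooth i k : smooth_in i (dom i) (fun x => Defs.coord i x 0 k).
Proof. by have := @transition_smooth _ _ rs i i k; rewrite setIid. Qed.

(** The interior of the zero set of f is closed: a point x of its closure lies in
    a disc centred at a point of the interior and contained in a chart, and
    [zero_propagation] fills that disc.  Connectedness concludes. *)
Lemma vanishing_everywhere f (kappa : S -> R) (Z : set S) :
  (forall x, {for x, continuous f}) -> (forall x, {for x, continuous kappa}) ->
  (forall x, 0 <= f x) ->
  (forall i, smooth_in i [set x | dom i x /\ 0 < f x] f) ->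
  (forall i x, dom i x -> 0 < f x ->
    kappa x <= laplacian i (fun y => ln (f y)) x) ->
  open Z -> Z !=set0 -> (forall x, Z x -> f x = 0) ->
  forall x, f x = 0.
Proof.
move=> cf ck f0 sf Lf oZ [z0 Zz0] fZ.
pose Z0 : set S := [set x | f x = 0]°.
have Z0x x : Z0 x -> f x = 0 by move=> /nbhs_singleton.
suff E : Z0 = setT by move=> x; apply: Z0x; rewrite E.
apply: (surface_connected rs).
- by exists z0; apply: filterS fZ _; apply: open_nbhs_nbhs.
- by exists Z0; [exact: open_interior|rewrite setTI].
exists Z0; last by rewrite setTI.
move=> x clx; have [i Dx] := dom_cover rs x.
have gm := surface_good_metric i; have gc : good_chart i := gm.
set c := Defs.coord i.
have : nbhs (c x) (c @` dom i).
  apply: open_nbhs_nbhs; split; last by exists x.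
  by apply: (gc_openmap gc) (gc_open gc).
move=> /nbhs_ballP [d4 /= d40 Hd4].
(* A disc of radius 2 d about a point at distance less than d from x contains
   x and stays within 3 d + d = d4 of x. *)
set d := d4 / 4; have d0 : 0 < d by rewrite divr_gt0.
have cc := gc_cont gc Dx.
have nV : nbhs x [set y | dom i y /\ ball (c x) d (c y)].
  apply: filterI; first exact: near_dom.
  by apply: cc; exact: nbhsx_ballx.
have [q0 [Zq0 [Dq0 bq0]]] := clx _ nV.
set q := c q0.
have disc v : sqdist q v <= (2 * d) ^+ 2 -> (c @` dom i) v.
  move=> h; apply: Hd4; rewrite (_ : d4 = d + 3 * d); last by rewrite /d; field.
  apply: ball_triangle bq0 _; apply: ball_sqdist; first by rewrite mulr_gt0.
  by apply: le_lt_trans h _; rewrite ltrXn2r // ?nnegrE ?mulr_ge0 ?ltW // ltr_pM2r // ltr_nat.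
have : \forall v \near q, exists y, [/\ dom i y, c y = v & f y = 0].
  exact: (near_chart gc Dq0 Zq0).
move=> /nbhs_ballP [et /= et0 Het].
set s := et / 2; have s0 : 0 < s by rewrite divr_gt0.
have s20 : 0 < s ^+ 2 by rewrite exprn_gt0.
have inner y : dom i y -> sqdist q (c y) <= s ^+ 2 -> f y = 0.
  move=> Dy h; have [|z [Dz Ez fz]] := Het (c y).
    apply: ball_sqdist => //; apply: le_lt_trans h _.
    by rewrite ltrXn2r ?nnegrE ?ltW // /s; lra.
  by rewrite -(gc_inj gc Dz Dy Ez).
have : nbhs x [set y | dom i y /\ sqdist q (c y) < (2 * d) ^+ 2].
  apply: filterI; first exact: near_dom.
  have := @sqdist_continuous R q (c x); move=> /(_ [set t | t < (2 * d) ^+ 2]) H.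
  move: cc => /(_ [set v | sqdist q v < (2 * d) ^+ 2]); apply; apply: H.
  apply: open_nbhs_nbhs; split; first exact: open_lt.
  have := sqdist_ball (ball_sym bq0) => /lt_trans; apply.
  have -> : (2 * d) ^+ 2 = 4 * d ^+ 2 by ring.
  by have := exprn_gt0 2 d0; lra.
apply: filterS => y [Dy hy].
exact: (zero_propagation gm (@surface_coord_smooth i) s20 disc (fun x _ => cf x)
  (fun x _ => f0 x) (sf i) (fun x _ => ck x) (Lf i) inner Dy hy).
Qed.

End Global.

(** * Regularity of the curvature and connectedness of the regular set *)

Section CurvatureRegularity.
Variables (R : realType) (S : surface R) (i : chart S).
Hypothesis gm : good_metric i.
Let gc : good_chart i := gm.
Let oD : open (dom i) := gc_open gc.
Let DD : dom i `<=` dom i := @subset_refl _ (dom i).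

Lemma smooth_chart_curvature : smooth_in i (dom i) (chart_curvature i).
Proof.
have M := smooth_inM gc oD DD; have A := smooth_inD gc oD DD.
have B := smooth_inB gc oD DD.
have sc := smooth_christoffel gm.
have dc k p l m := smooth_in_pderiv k (sc p l m).
have sr p : smooth_in i (dom i) (riemann i p 0 1 1).
  apply: (smooth_in_eq gc oD DD) (A _ _ (B _ _ (dc 0 p 1 1) (dc 1 p 0 1))
    (A _ _ (B _ _ (M _ _ (sc 0 1 1) (sc p 0 0)) (M _ _ (sc 0 0 1) (sc p 1 0)))
           (B _ _ (M _ _ (sc 1 1 1) (sc p 0 1)) (M _ _ (sc 1 0 1) (sc p 1 1))))).
  by move=> x _; rewrite riemannE.
have sg := smooth_mcomp gm.
apply: (smooth_in_eq gc oD DD) (M _ _ (A _ _ (M _ _ (sr 0) (sg 0 0)) (M _ _ (sr 1) (sg 1 0)))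
  (smooth_mdetV gm)).
by move=> x Dx; rewrite chart_curvatureE (mdetE gm Dx).
Qed.

Lemma laplacian_near (f g : S -> R) x : dom i x -> (\forall y \near x, f y = g y) ->
  laplacian i f x = laplacian i g x.
Proof.
move=> Dx E; rewrite /laplacian /divergence -pdE; congr (_ * _).
apply: eq_bigr => k _; apply: (pd_near gc _ Dx).
apply: filterS (filterI (near_dom gc Dx) (nbhs_interior E)) => y [Dy Ey].
rewrite /grad -pdE; congr (_ * _); apply: eq_bigr => l _; congr (_ * _).
exact: (pd_near gc _ Dy Ey).
Qed.

End CurvatureRegularity.

Section RicciSurface.
Variables (R : realType) (S : surface R) (a b c : R) (K : S -> R).
Hypothesis rs : riemannian_surface S.
Hypothesis hK : gaussian_curvature K.
Hypothesis ricci : forall (i : chart S) (x : S), dom i x ->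
  (c - K x) * laplacian i K x + sq_norm i (grad i K x) x
        + (a * K x + b) * (K x - c) ^+ 2 = 0.
Variable s : R.
Local Notation w := (fun x => s * (K x - c)).

Lemma smooth_K i : smooth_in i (dom i) K.
Proof.
have gm := surface_good_metric rs i.
apply: (smooth_in_eq gm (gc_open gm) (@subset_refl _ _)) (smooth_chart_curvature gm) => x Dx.
by rewrite (hK Dx).
Qed.

Lemma K_continuous x : {for x, continuous K}.
Proof.
by have [i Dx] := dom_cover rs x; exact: smooth_in_continuous (@smooth_K i) Dx.
Qed.

Lemma smooth_w i : smooth_in i (dom i) w.
Proof.
have gm := surface_good_metric rs i; have oD := gc_open gm.
have DD := @subset_refl _ (dom i).
have C := smooth_in_cst gm oD DD.
exact: (smooth_inM gm oD DD (C s) (smooth_inB gm oD DD (@smooth_K i) (C c))).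
Qed.

(** The Ricci equation multiplied by s^2. *)
Lemma w_ricci i x : dom i x ->
  w x * laplacian i w x - sqgrad i w x = (a * K x + b) * w x ^+ 2.
Proof.
move=> Dx; have gm := surface_good_metric rs i; have oD := gc_open gm.
have DD := @subset_refl _ (dom i).
have d1 y : dom i y -> is_derive (K y) (1:R) (fun t : R => s * (t - c)) s.
  move=> _; have h : is_derive (K y) (1:R) (fun t : R => t - c) 1.
    exact: is_derive_shift.
  by have := is_deriveZ s h; rewrite [s *: 1]mulr1.
have d2 y : dom i y -> is_derive (K y) (1:R) (fun _ : R => s) 0.
  by move=> _; exact: is_derive_cst.
rewrite (laplacian_chain gm oD DD (phi := fun t => s * (t - c)) (phi1 := fun _ => s)
   (phi2 := fun _ => 0) (@smooth_K i) (@smooth_w i) d1 d2 Dx).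
rewrite (sqgrad_chain gm DD (phi := fun t => s * (t - c)) (phi1 := fun _ => s)
   (@smooth_K i) d1 Dx).
have := ricci Dx; rewrite (sq_norm_gradE gm _ Dx).
move: (laplacian _ _ _) (sqgrad _ _ _) (K x) => L G k E.
have -> : s * (k - c) * (s * L + 0 * G) - s ^+ 2 * G = s * s * ((k - c) * L - G) by ring.
have -> : (a * k + b) * (s * (k - c)) ^+ 2 = s * s * ((a * k + b) * (k - c) ^+ 2) by ring.
by congr (_ * _); move: E; lra.
Qed.

Lemma laplacian_ln_w (i : chart S) (W : set S) x : open W -> W `<=` dom i ->
  (forall y, W y -> 0 < w y) -> W x ->
  laplacian i (fun y => ln (w y)) x = a * K x + b.
Proof.
move=> oW WD w0 Wx; have gm := surface_good_metric rs i.
rewrite (laplacian_ln gm oW WD (smooth_in_sub WD (@smooth_w i)) w0 Wx).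
have := w_ricci (WD _ Wx); have := w0 _ Wx.
move: (laplacian _ _ _) (sqgrad _ _ _) (s * (K x - c)) (a * K x + b) => L G k r.
move=> /gt_eqF /negbT k0 E.
have -> : k^-1 * L - k ^- 2 * G = (k * L - G) / k ^+ 2 by field.
by rewrite E; field.
Qed.

(** The function equal to w on P and to 0 elsewhere is continuous, because the
    boundary points of P are zeros of K - c.  It vanishes on Q, so if Q were
    nonempty it would vanish on P too. *)
Lemma regular_part_connected (P Q : set S) : open P -> open Q -> P `&` Q = set0 ->
  P `|` Q = [set x | K x <> c] -> (forall x, P x -> 0 < w x) ->
  P !=set0 -> Q = set0.
Proof.
move=> oP oQ PQ0 PQ w0 [p Pp]; apply/eqP; apply: contraT => /set0P Q0.
pose f x := if `[< P x >] then w x else 0.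
have fP x : P x -> f x = w x by move=> Px; rewrite /f asboolT.
have fnP x : ~ P x -> f x = 0 by move=> Px; rewrite /f asboolF.
have fQ x : Q x -> f x = 0.
  move=> Qx; apply: fnP => Px.
  by have : (P `&` Q) x by []; rewrite PQ0.
have nearP x : P x -> \forall y \near x, f y = w y.
  by move=> Px; apply: filterS fP _; apply: open_nbhs_nbhs.
have fpos x : 0 < f x -> P x.
  by move=> h; apply: contrapT => nP; move: h; rewrite fnP // ltxx.
have cw x : {for x, continuous w}.
  apply: continuousM; first exact: cst_continuous.
  by apply: continuousB; [exact: K_continuous|exact: cst_continuous].
suff f0 : forall x, f x = 0 by have := w0 _ Pp; rewrite -fP // f0 ltxx.
apply: (vanishing_everywhere rs (kappa := fun x => a * K x + b) _ _ _ _ _ oQ Q0 fQ).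
- move=> x; have [Px|nPx] := pselect (P x).
    move=> A; rewrite /= fP // => /(cw x) /= H.
    suff: \forall y \near x, A (f y) by [].
    have {}H : \forall y \near x, A (w y) by exact: H.
    by apply: filterS2 H (nearP x Px) => y + ->.
  have [Qx|nQx] := pselect (Q x).
    move=> A; rewrite /= fQ // => H.
    suff: \forall y \near x, A (f y) by [].
    have nQ : \forall y \near x, Q y by apply: open_nbhs_nbhs.
    by apply: filterS nQ => y /fQ ->; exact: nbhs_singleton.
  have Kx : K x = c.
    apply: contrapT => h; have : (P `|` Q) x by rewrite PQ.
    by case.
  apply/cvgrPdist_lt => eps eps0; rewrite /= fnP //.
  have := cw x; move=> /cvgrPdist_lt /(_ eps eps0).
  apply: filterS => y; rewrite Kx subrr mulr0 /f.
  by case: asboolP => // _ _; rewrite subrr normr0.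
- move=> x; apply: continuousD; last exact: cst_continuous.
  by apply: continuousM; [exact: cst_continuous|exact: K_continuous].
- by move=> x; rewrite /f; case: asboolP => // /w0 /ltW.
- move=> i; have gm := surface_good_metric rs i.
  have -> : [set x | dom i x /\ 0 < f x] = dom i `&` P.
    apply/seteqP; split => x /= [Dx]; first by move=> /fpos.
    by move=> Px; split=> //; rewrite fP // w0.
  have o : open (dom i `&` P) by apply: openI => //; exact: gc_open gm.
  apply: (smooth_in_eq gm o (@subIsetl _ _ _)) (smooth_in_sub (@subIsetl _ _ _) (@smooth_w i)).
  by move=> x [_ Px]; rewrite fP.
- move=> i x Dx /fpos Px; have gm := surface_good_metric rs i.
  have o : open (dom i `&` P) by apply: openI => //; exact: gc_open gm.
  have E : \forall y \near x, ln (f y) = ln (w y).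
    by apply: filterS (nearP x Px) => y ->.
  rewrite (laplacian_near gm Dx E) (laplacian_ln_w o (@subIsetl _ _ _)) //.
  by move=> y [_ Py]; exact: w0.
Qed.

End RicciSurface.

(** * Restriction to an open subset *)

Section Restriction.
Variables (R : realType) (S : surface R) (A : set S) (u : S -> R).
Hypothesis oA : open A.
Let T := conformal_restriction A u.
Let S' := conformal u.
Local Notation incl := (fun y : T => set_val (y : A)).
Implicit Types (i : chart S) (f : S -> R) (x : T).

Lemma open_restrictionP (V : set T) : open V <->
  exists2 V' : set S, open V' & V = incl @^-1` V'.
Proof. by split=> -[V' oV E]; exists V' => //; rewrite E. Qed.

Lemma incl_in x : A (incl x).
Proof. exact: set_valP. Qed.

Lemma incl_surj (y : S) : A y -> exists x : T, incl x = y.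
Proof. by move=> Ay; exists (SigSub (mem_set Ay)). Qed.

Lemma incl_inj (x y : T) : incl x = incl y -> x = y.
Proof. exact: val_inj. Qed.

Lemma incl_continuous x : {for x, continuous incl}.
Proof. exact: initial_continuous. Qed.

Section Chart.
Variable i : chart S.
Hypothesis gc : good_chart i.
Let iT : chart T := i.

Lemma good_chart_restriction : good_chart iT.
Proof.
split.
- by apply/open_restrictionP; exists (dom i) => //; exact: gc_open gc.
- by move=> x y Dx Dy E; apply: incl_inj; exact: (gc_inj gc Dx Dy E).
- move=> x Dx; apply: (@continuous_comp _ _ _ incl (Defs.coord i)).
    exact: incl_continuous.
  exact: (gc_cont gc).
- move=> V VD /open_restrictionP [V' oV' EV].
  have -> : Defs.coord iT @` V = Defs.coord i @` (V' `&` (A `&` dom i)).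
    apply/seteqP; split => v /=.
      move=> [x Vx <-]; exists (incl x) => //; split; first by rewrite EV in Vx.
      by split; [exact: incl_in | exact: VD].
    move=> [y [Vy [Ay Dy]] <-]; have [x Ex] := incl_surj Ay.
    by exists x; [rewrite EV /= Ex | rewrite -Ex].
  apply: (gc_openmap gc); first by move=> y [_ []].
  by apply: openI => //; apply: openI => //; exact: gc_open gc.
Qed.
Let gcT := good_chart_restriction.

(** Near a point of A, a chart of S and its restriction to A have the same
    image, so a function and its restriction are read in the same way. *)
Lemma near_in_chart_restriction f x : dom i (incl x) ->
  \forall v \near Defs.coord i (incl x), in_chart iT (f \o incl) v = in_chart i f v.
Proof.
move=> Dx.
have nA : nbhs (incl x) A by apply: open_nbhs_nbhs; split => //; exact: incl_in.
apply: filterS (near_chart gc Dx nA) => v [y [Dy <- Ay]].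
have [z Ez] := incl_surj Ay; rewrite -Ez.
have DzT : dom iT z by rewrite /= Ez.
by rewrite (in_chartE gcT (f \o incl) DzT) in_chartE // Ez.
Qed.

Lemma pd_restriction k f x : dom i (incl x) ->
  pd iT k (f \o incl) x = pd i k f (incl x).
Proof.
by move=> Dx; rewrite pdE; apply: near_eq_derive; exact: near_in_chart_restriction.
Qed.

Lemma smooth_restriction (W : set S) f : W `<=` dom i ->
  smooth_in i W f -> smooth_in iT (incl @^-1` W) (f \o incl).
Proof.
move=> WD /smooth_inP H; apply/smooth_inP => s x Wx.
have E : forall y : T, dom i (incl y) -> foldr (pd iT) (f \o incl) s y = foldr (pd i) f s (incl y).
  elim: s {H} => [|k s IH] y Dy //=.
  rewrite -pd_restriction //; apply: (pd_near gcT) => //.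
  by apply: filterS (near_dom gcT (Dy : dom iT y)) => z; exact: IH.
have Dx := WD _ Wx; have [cs ds] := H s _ Wx.
have nE : \forall y \near x, (foldr (pd i) f s \o incl) y = foldr (pd iT) (f \o incl) s y.
  by apply: filterS (near_dom gcT (Dx : dom iT x)) => z Dz; rewrite E.
split.
  have c1 : {for x, continuous (foldr (pd i) f s \o incl)}.
    by apply: continuous_comp; [exact: incl_continuous|exact: cs].
  move=> B; rewrite /= E // => /c1 /= h.
  suff: \forall y \near x, B (foldr (pd iT) (f \o incl) s y) by [].
  have {}h : \forall y \near x, B ((foldr (pd i) f s \o incl) y) by exact: h.
  by apply: filterS2 h nE => y + <-.
move=> k; apply: near_eq_derivable (ds k).
have h1 := near_in_chart_restriction (foldr (pd i) f s) Dx.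
have h2 := near_eq_in_chart gcT (Dx : dom iT x) nE.
by apply: filterS2 h1 h2 => v <- ->.
Qed.

Let iS : chart S' := i.

Lemma christoffel_restriction k l m x : dom i (incl x) ->
  christoffel iT k l m x = christoffel iS k l m (incl x).
Proof.
move=> Dx; rewrite !christoffelE /dmetric !pd_conf.
have E n p q : pd iT n (mcomp iT p q) x = pd i n (mcomp iS p q) (incl x).
  exact: (pd_restriction n (mcomp iS p q) Dx).
by rewrite !E.
Qed.

Lemma chart_curvature_restriction x : dom i (incl x) ->
  chart_curvature iT x = chart_curvature iS (incl x).
Proof.
move=> Dx; rewrite !chart_curvatureE !riemannE !pd_conf !christoffel_restriction //.
have E n k l m : pd iT n (christoffel iT k l m) x = pd i n (christoffel iS k l m) (incl x).
  rewrite -(pd_restriction _ _ Dx); apply: (pd_near gcT) => //.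
  by apply: filterS (near_dom gcT (Dx : dom iT x)) => y; exact: christoffel_restriction.
by rewrite !E.
Qed.

Lemma grad_restriction f x k : dom i (incl x) ->
  grad iT (f \o incl) x k = grad iS f (incl x) k.
Proof.
move=> Dx; rewrite /grad -pdE; apply: eq_bigr => l _.
by rewrite pd_restriction // pd_conf.
Qed.

Lemma laplacian_restriction f x : dom i (incl x) ->
  laplacian iT (f \o incl) x = laplacian iS f (incl x).
Proof.
move=> Dx; rewrite /laplacian /divergence -pdE; congr (_ * _).
apply: eq_bigr => k _; rewrite pd_conf -(pd_restriction _ _ Dx).
apply: (pd_near gcT) => //.
apply: filterS (near_dom gcT (Dx : dom iT x)) => y Dy.
by rewrite grad_restriction.
Qed.

End Chart.
End Restriction.

Section RestrictedSurface.
Variables (R : realType) (S : surface R) (A : set S) (u : S -> R).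
Hypothesis rs : riemannian_surface S.
Hypothesis oA : open A.
Hypothesis u_gt0 : forall x, A x -> 0 < u x.
Hypothesis su : forall i, smooth_in i (dom i) u.
Let T := conformal_restriction A u.
Hypothesis conn : connected [set: T].
Local Notation incl := (fun y : T => set_val (y : A)).

Lemma restriction_hausdorff : hausdorff_space T.
Proof.
move=> p q clu; apply: incl_inj; apply: (surface_hausdorff rs) => B C nB nC.
have [z [Bz Cz]] := clu _ _ (incl_continuous nB) (incl_continuous nC).
by exists (incl z).
Qed.

Lemma restriction_second_countable : @second_countable T.
Proof.
have [B cB [oB hB]] := surface_second_countable rs.
exists ((fun V : set S => incl @^-1` V) @` B).
  exact: card_le_trans (card_image_le _ _) cB.
split=> [_ [V /oB oV <-]|x N]; first by apply/open_restrictionP; exists V.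
rewrite /= nbhsE => -[V [oV Vx] VN].
have [V' oV' EV] := (@open_restrictionP R S A u V).1 oV; rewrite EV in Vx VN.
have [W [BW Wx] WV'] := hB (incl x) V' (open_nbhs_nbhs (conj oV' Vx)).
exists (incl @^-1` W); first by split => //; exists W.
by move=> y /= Wy; apply: VN; exact: WV'.
Qed.

Lemma smooth_scaled_metric (i : chart S) k l :
  smooth_in i (dom i) (fun z => u z * metric i z k l).
Proof.
have gm := surface_good_metric rs i.
exact: (smooth_inM gm (gc_open gm) (@subset_refl _ _) (@su i) (smooth_mcomp gm k l)).
Qed.

Lemma restriction_riemannian : riemannian_surface T.
Proof.
have gm i := surface_good_metric rs i.
have gcT i := good_chart_restriction u oA (gm i : good_chart i).
split.
- exact: conn.
- exact: restriction_hausdorff.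
- exact: restriction_second_countable.
- by move=> i; exact: gc_open (gcT i).
- by move=> x; have [i Dx] := dom_cover rs (incl x); exists i.
- by move=> i; exact: gc_inj (gcT i).
- by move=> i; exact: gc_cont (gcT i).
- by move=> i; exact: gc_openmap (gcT i).
- move=> i j k.
  have sub : (dom (i : chart S) `&` dom (j : chart S)) `<=` dom (i : chart S) by exact: subIsetl.
  have H := @smooth_restriction R S A u oA i (gm i) _
    (fun x => Defs.coord (j : chart S) x 0 k) sub.
  by apply: H; exact: (@transition_smooth _ _ rs i j k).
- move=> i k l.
  have -> : (fun x : T => metric (i : chart T) x k l) = (fun z => u z * metric (i : chart S) z k l) \o incl.
    by apply/funext => x; rewrite /= mxE.
  have H := @smooth_restriction R S A u oA i (gm i) (dom (i : chart S))
    (fun z => u z * metric (i : chart S) z k l) (@subset_refl _ _).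
  by apply: H; exact: smooth_scaled_metric.
- move=> i x Dx; rewrite /= linearZ /=.
  by rewrite (gm_sym (gm i) Dx).
- move=> i x v Dx v0; rewrite /= -scalemxAr -scalemxAl mxE mulr_gt0 //.
    by apply: u_gt0; exact: (@incl_in R S A u x).
  exact: (gm_pos (gm i)).
- move=> i j x Dx Dy J.
  have -> : J = \matrix_(k < 2, l < 2) pderiv (i : chart S) k (fun y => Defs.coord (j : chart S) y 0 l) (incl x).
    apply/matrixP => k l; rewrite !mxE -pdE.
    exact: (pd_restriction oA (gm i) k (fun y => Defs.coord (j : chart S) y 0 l) Dx).
  rewrite /= -scalemxAr -scalemxAl; congr (_ *: _).
  exact: (metric_transition rs).
Qed.

Lemma sqgrad_restriction i f x : dom i (incl x) ->
  @sqgrad R T i (f \o incl) x = @sqgrad R (conformal u) i f (incl x).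
Proof.
move=> Dx; have gm := surface_good_metric rs i.
by rewrite /sqgrad !(pd_restriction oA gm _ _ Dx) !pd_conf.
Qed.

End RestrictedSurface.

(** * The conformal metric of a Ricci surface *)

Section Dual.
Variables (R : realType) (S : surface R) (a b c : R) (K : S -> R).
Hypothesis rs : riemannian_surface S.
Hypothesis hK : gaussian_curvature K.
Hypothesis ricci : forall (i : chart S) (x : S), dom i x ->
  (c - K x) * laplacian i K x + sq_norm i (grad i K x) x
        + (a * K x + b) * (K x - c) ^+ 2 = 0.
Variable s : R.
Hypothesis s2 : s * s = 1.
Local Notation w := (fun x => s * (K x - c)).
Local Notation A := [set x | K x <> c].
Hypothesis w_gt0 : forall x, A x -> 0 < w x.
Let T := conformal_restriction A w.
Local Notation incl := (fun y : T => set_val (y : A)).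

Lemma open_regular : open A.
Proof.
have -> : A = K @^-1` (~` [set c]) by [].
apply: open_comp; first by move=> x _; exact: (K_continuous rs hK).
by apply: closed_openC; exact: closed_eq.
Qed.

(** A subset of A that is open and closed in A splits A into two open subsets of
    S; one of them is empty by [regular_part_connected]. *)
Lemma restriction_connected : connected [set: T].
Proof.
move=> B [x Bx] [C oC EC] [C' cC' EC']; rewrite !setTI in EC EC'.
have [V1 oV1 E1] := (@open_restrictionP R S A w B).1 (eq_ind_r open oC EC).
have [V2 oV2 E2] : exists2 V : set S, open V & ~` B = incl @^-1` V.
  by apply/open_restrictionP; rewrite EC'; exact: closed_openC.
have Q0 : A `&` V2 = set0.
  apply: (@regular_part_connected R S a b c K rs hK ricci s (A `&` V1)).
  - exact: openI open_regular oV1.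
  - exact: openI open_regular oV2.
  - apply/seteqP; split => // y [[Ay V1y] [_ V2y]].
    have [z Ez] := @incl_surj R S A w y Ay.
    have Bz : B z by rewrite E1 /= Ez.
    by have : (~` B) z by rewrite E2 /= Ez.
  - apply/seteqP; split => y; first by move=> [[]|[]].
    move=> Ay; have [z Ez] := @incl_surj R S A w y Ay.
    have [Bz|Bz] := pselect (B z).
      by left; split => //; rewrite -Ez; rewrite E1 in Bz.
    by right; split => //; rewrite -Ez; have : (~` B) z by []; rewrite E2.
  - by move=> y [Ay _]; exact: w_gt0.
  - exists (incl x); split; first exact: (@incl_in R S A w x).
    by rewrite E1 in Bx.
apply/seteqP; split => // y _; apply: contrapT => By.
have : (~` B) y by []; rewrite E2 => V2y.
have : (A `&` V2) (incl y) by split => //; exact: (@incl_in R S A w y).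
by rewrite Q0.
Qed.

Lemma dual_riemannian : riemannian_surface T.
Proof.
apply: restriction_riemannian => //.
- exact: open_regular.
- by move=> i; exact: (@smooth_w R S c K rs hK s i).
- exact: restriction_connected.
Qed.

Let kap := - ((b + (a - 2) * c) / 2).
Let ct := s * (1 - a / 2).
Let Kt : S -> R := fun x => ct + kap * (w x)^-1.

Section AtPoint.
Variables (i : chart S) (x : T).
Hypothesis Dx : dom i (incl x).
Let W := dom i `&` A.
Let gm : good_metric i := surface_good_metric rs i.
Let oW : open W := openI (gc_open gm) open_regular.
Let WD : W `<=` dom i := @subIsetl _ _ _.
Let Wx : W (incl x) := conj Dx (@incl_in R S A w x).
Let sw : smooth_in i W w := smooth_in_sub WD (@smooth_w R S c K rs hK s i).
Let w0 y (Wy : W y) : 0 < w y := w_gt0 Wy.2.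

(** By the conformal change formula the curvature is w^-1 (K - (a K + b) / 2). *)
Lemma dual_curvature : @chart_curvature R T i x = Kt (incl x).
Proof.
rewrite (chart_curvature_restriction open_regular gm Dx).
rewrite (chart_curvature_conf gm oW WD sw w0 Wx).
rewrite (laplacian_ln_w rs hK ricci oW WD w0 Wx) -(hK Dx) /Kt /ct /kap.
have := w0 Wx; move: (K (incl x)) => k /gt_eqF /negbT.
rewrite mulf_eq0 negb_or => /andP [s0 k0].
have -> : s * (1 - a / 2) = s * s * (1 - a / 2) / s by field.
by rewrite s2; field; rewrite s0 k0.
Qed.

(** By the chain rule for t |-> ct + kap / t, the left-hand side is a multiple
    of the difference between the two sides of [w_ricci]. *)
Lemma dual_ricci :
  let at' := 2 * (a * c + b) / (b + (a - 2) * c) in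
  let bt := - (2 * s * b) / (b + (a - 2) * c) in
  b <> (2 - a) * c ->
  (ct - Kt (incl x)) * @laplacian R T i (Kt \o incl) x +
  @sq_norm R T i (@grad R T i (Kt \o incl) x) x +
  (at' * Kt (incl x) + bt) * (Kt (incl x) - ct) ^+ 2 = 0.
Proof.
move=> at' bt hb.
have d0 : b + (a - 2) * c != 0.
  by apply/eqP => h; apply: hb; move: h; lra.
rewrite (laplacian_restriction open_regular gm _ Dx).
rewrite (laplacian_conf gm oW WD w0 _ Wx).
have gmT : good_metric (i : chart T) := surface_good_metric dual_riemannian i.
rewrite (sq_norm_gradE gmT _ (Dx : dom (i : chart T) x)).
rewrite (sqgrad_restriction rs open_regular _ Dx) (sqgrad_conf gm WD w0 _ Wx).
have d1 y : W y -> is_derive (w y) (1:R) (fun t : R => ct + kap * t^-1) (- kap * (w y) ^- 2).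
  move=> /w0 /gt_eqF /negbT wy0.
  have := is_deriveD (is_derive_cst ct (w y) (1:R)) (is_deriveZ kap (is_derive_inv wy0)).
  move=> h; apply: is_derive_eq h _.
  by rewrite add0r; exact: etrans (mulrN _ _) (esym (mulNr _ _)).
have d2 y : W y -> is_derive (w y) (1:R) (fun t : R => - kap * t ^- 2) (2 * kap * (w y) ^- 3).
  move=> /w0 /gt_eqF /negbT wy0; have v := is_derive_inv wy0.
  have -> : (fun t : R => - kap * t ^- 2) =
     - kap *: ((fun t : R => t^-1) * (fun t : R => t^-1)).
    by apply/funext => t; rewrite expr2 invfM.
  apply: is_derive_eq (is_deriveZ (- kap) (is_deriveM v v)) _.
  rewrite -![_ *: _]/(_ * _); move: (s * _) wy0 => k k0.
  by field.
have sK : smooth_in i W Kt.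
  have C := smooth_in_cst gm oW WD.
  apply: (smooth_inD gm oW WD (C ct)); apply: (smooth_inM gm oW WD (C kap)).
  by apply: (smooth_inV gm oW WD) sw => y /w0 /gt_eqF /negbT.
rewrite (laplacian_chain gm oW WD (phi := fun t => ct + kap * t^-1)
  (phi1 := fun t => - kap * t ^- 2) (phi2 := fun t => 2 * kap * t ^- 3) sw sK d1 d2 Wx).
rewrite (sqgrad_chain gm WD (phi := fun t => ct + kap * t^-1)
  (phi1 := fun t => - kap * t ^- 2) sw d1 Wx).
have := w_ricci rs hK ricci s Dx; have := w0 Wx.
have -> : a * K (incl x) + b = s * a * w (incl x) + (a * c + b).
  have -> : s * a * (s * (K (incl x) - c)) = s * s * a * (K (incl x) - c) by ring.
  by rewrite s2; ring.
rewrite /Kt /=; move: (laplacian _ _ _) (sqgrad _ _ _) (s * (K (incl x) - c)) => L G k.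
move=> /gt_eqF /negbT k0 E.
have -> : G = k * L - (s * a * k + (a * c + b)) * k ^+ 2 by rewrite -E; ring.
by rewrite /at' /bt /ct /kap; field; rewrite d0 k0.
Qed.
End AtPoint.
End Dual.

(** * Sign of the curvature and conclusion *)

Section ConstantSign.
Variables (R : realType) (S : surface R) (a b c : R) (K : S -> R).
Hypothesis rs : riemannian_surface S.
Hypothesis hK : gaussian_curvature K.
Hypothesis ricci : forall (i : chart S) (x : S), dom i x ->
  (c - K x) * laplacian i K x + sq_norm i (grad i K x) x
        + (a * K x + b) * (K x - c) ^+ 2 = 0.
Hypothesis hKc : ~ (forall x : S, K x = c).

Lemma constant_sign : (forall x, c <= K x) \/ (forall x, K x <= c).
Proof.
have cK (B : set R) : open B -> open (K @^-1` B).
  by move=> oB; apply: open_comp => // x _; exact: (K_continuous rs hK).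
have [[p /= Kp]|noP] := pselect ([set x | c < K x] !=set0); last first.
  by right=> x; rewrite leNgt; apply/negP => h; apply: noP; exists x.
left=> x; rewrite leNgt; apply/negP => Kx.
have Q0 : [set x | K x < c] = set0.
  apply: (@regular_part_connected R S a b c K rs hK ricci 1 [set x | c < K x]).
  - by apply: (cK [set t | c < t]); exact: open_gt.
  - by apply: (cK [set t | t < c]); exact: open_lt.
  - by apply/seteqP; split => // y [/= h1 /(lt_trans h1)]; rewrite ltxx.
  - apply/seteqP; split => y /=.
      by move=> [h|h] E; move: h; rewrite E ltxx.
    by move=> /eqP; rewrite neq_lt => /orP [?|?]; [right|left].
  - by move=> y /= h; rewrite mul1r subr_gt0.
  - by exists p.
by have : [set x | K x < c] x by []; rewrite Q0.
Qed.

(** The hypothesis [hKc] excludes the junk value of [fsign]. *)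
Lemma fsign_curvature : exists s : R, [/\ fsign (fun x : S => K x - c) = s, s * s = 1,
  (forall x, `|K x - c| = s * (K x - c)) & forall x, K x <> c -> 0 < s * (K x - c)].
Proof.
have [x0 Kx0] : exists x, K x != c.
  apply: contrapT => h; apply: hKc => x; apply: contrapT => h'.
  by apply: h; exists x; apply/eqP.
have ne0 : exists x, K x - c != 0 by exists x0; rewrite subr_eq0.
have [ge|le] := constant_sign.
- exists 1; split; rewrite ?mul1r //.
  + by rewrite /fsign asboolT //; split => // x; rewrite subr_ge0.
  + by move=> x; rewrite mul1r ger0_norm // subr_ge0.
  + by move=> x /eqP h; rewrite mul1r subr_gt0 lt_neqAle eq_sym h ge.
- exists (-1); split; rewrite ?mulrNN ?mul1r //.
  + rewrite /fsign asboolF; last first.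
      move=> [h _]; have := h x0; rewrite subr_ge0 => h0.
      by move/eqP: Kx0; apply; apply/eqP; rewrite eq_le le h0.
    by rewrite asboolT //; split => // x; rewrite subr_le0.
  + by move=> x; rewrite mulN1r ler0_norm // subr_le0.
  + by move=> x /eqP h; rewrite mulN1r oppr_gt0 subr_lt0 lt_neqAle h le.
Qed.

End ConstantSign.

Theorem corollary2p12 (R : realType) (a b c : R) (hb : b <> (2 - a) * c)
  (S : surface R) (hS : generalized_ricci_surface S a b c)
  (K : S -> R) (hK : gaussian_curvature K) (hKc : ~ (forall x : S, K x = c)) :
  let Sigma_star : set S := [set x | K x <> c] in
  let eps : R := fsign (fun x : S => K x - c) in
  let S_star := conformal_restriction Sigma_star (fun x : S => `|K x - c|) in
  generalized_ricci_surface S_star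
    (2 * (a * c + b) / (b + (a - 2) * c))
    (- (2 * eps * b) / (b + (a - 2) * c))
    (eps * (1 - a / 2)) /\
  forall Kt : S_star -> R, gaussian_curvature Kt ->
    forall x : Sigma_star,
      Kt x - eps * (1 - a / 2) =
      - ((b + (a - 2) * c) / 2) * eps * (K (set_val x) - c)^-1.
Proof.
have [rs [K0 hK0 ricci0]] := hS.
have EK : K0 = K.
  apply/funext => x; have [i Dx] := dom_cover rs x.
  by rewrite (hK0 i x Dx) (hK i x Dx).
rewrite {}EK in ricci0 hK0.
have [s [Es s2 Ea w0]] := fsign_curvature rs hK ricci0 hKc.
move=> Sigma_star eps S_star.
have Eu : (fun x : S => `|K x - c|) = (fun x => s * (K x - c)) by apply/funext.
rewrite {}/S_star {}/eps Es Eu {Eu Ea Es}.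
set T := conformal_restriction _ _.
have rT : riemannian_surface T := dual_riemannian rs hK ricci0 w0.
have curv := dual_curvature rs hK ricci0 s2 w0.
split.
  split => //.
  eexists; first by move=> i x Dx; symmetry; exact: curv Dx.
  by move=> i x Dx; exact: (dual_ricci rs hK ricci0 s2 w0 Dx hb).
move=> Kt hKt x; have [i Dx] := dom_cover rT x.
rewrite (hKt i x Dx) (curv i x Dx) addrC addKr invfM -mulrA; congr (_ * (_ * _)).
have s0 : s != 0.
  by apply/eqP => E; move/eqP: s2; rewrite E mul0r eq_sym oner_eq0.
by apply: (mulfI s0); rewrite mulfV.
Qed.
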